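(* Let $M$ be a von Neumann algebra, let $A$ be a unital $C^*$-algebra, let $C\subset A$ be a sub-$C^*$-algebra containing the unit of $A$, and let $\pi\colon C\to M$ be a unital $*$-homomorphism. Let $u\colon A\to M$ be a $C$-bimodule map with respect to $\pi$, and assume that $u$ is decomposable. If $\pi$ admits a completely positive extension $A\to M$, then there exist completely positive maps $u_1,u_2,u_3,u_4\colon A\to M$, each of which is a $C$-bimodule map with respect to $\pi$, such that $u=(u_1-u_2)+i(u_3-u_4)$.
   Context: A bounded linear map $u\colon A\to M$ is called a $C$-bimodule map with respect to $\pi$ if $u(c_1ac_2)=\pi(c_1)u(a)\pi(c_2)$ for all $a\in A$ and all $c_1,c_2\in C$. A linear map $u\colon A\to M$ is called decomposable if there exist four completely positive maps $v_1,v_2,v_3,v_4\colon A\to M$ (not required to be bimodule maps) such that $u=(v_1-v_2)+i(v_3-v_4)$. A completely positive extension of $\pi$ is a completely positive map $\widehat{\pi}\colon A\to M$ whose restriction to $C$ equals $\pi$. *)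

(* Defs.v *)
From HB Require Import structures.
From mathcomp Require Import all_boot all_order all_algebra.
From mathcomp Require Import complex.
From mathcomp Require Import all_classical all_reals all_analysis.

Set Implicit Arguments.
Unset Strict Implicit.
Unset Printing Implicit Defensive.
Import Order.TTheory GRing.Theory Num.Theory.
Import numFieldNormedType.Exports.

Local Open Scope classical_set_scope.
Local Open Scope complex_scope.
Local Open Scope ring_scope.

(** Unital complex C*-algebras, on top of complex Banach spaces. The norm takes
    its values in [R[i]], where [0 <= z] means that [z] is a nonnegative real.
    The zero algebra is allowed. In the MathComp hierarchy the only rings with a
    norm are the [numDomainType]s, and no common substructure of rings and
    normed spaces can be inserted below them afterwards: the product is
    therefore part of the mixin, and the ring structure is derived from it. *)
HB.mixin Record isCStar (R : realType) A of CompleteNormedModule R[i] A := {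
  cmul : A -> A -> A ;
  cone : A ;
  star : A -> A ;
  cmulA : associative cmul ;
  cmul1 : left_id cone cmul ;
  cmulr1 : right_id cone cmul ;
  cmulDl : left_distributive cmul +%R ;
  cmulDr : right_distributive cmul +%R ;
  cmulZl : forall (k : R[i]) (x y : A), k *: cmul x y = cmul (k *: x) y ;
  cmulZr : forall (k : R[i]) (x y : A), k *: cmul x y = cmul x (k *: y) ;
  cmul_norm : forall x y : A, `|cmul x y| <= `|x| * `|y| ;
  starK : involutive star ;
  starD : {morph star : x y / x + y} ;
  starZ : forall (k : R[i]) (x : A), star (k *: x) = k^* *: star x ;
  starM : forall x y : A, star (cmul x y) = cmul (star y) (star x) ;
  cstar_norm : forall x : A, `|cmul (star x) x| = `|x| ^+ 2
}.

#[short(type="cstarType")]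
HB.structure Definition CStar (R : realType) :=
  {A of isCStar R A & CompleteNormedModule R[i] A}.

HB.instance Definition _ (R : realType) (A : cstarType R) :=
  GRing.Zmodule_isPzRing.Build (CStar.sort A)
    (@cmulA R A) (@cmul1 R A) (@cmulr1 R A) (@cmulDl R A) (@cmulDr R A).

Definition bounded_map (R : realType) (V W : normedModType R[i])
  (f : V -> W) : Prop :=
  exists k : R[i], forall x : V, `|f x| <= k * `|x|.

Record sub_cstar_algebra (R : realType) (A : cstarType R) (C : set A) : Prop := {
  sub_cstar0 : C 0 ;
  sub_cstarD : forall x y, C x -> C y -> C (x + y) ;
  sub_cstarZ : forall (k : R[i]) x, C x -> C (k *: x) ;
  sub_cstarM : forall x y, C x -> C y -> C (x * y) ;
  sub_cstar_star : forall x, C x -> C (star x) ;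
  sub_cstar_closed : closed C
}.

(** A map [C -> M] is represented by a function on [A] of which only the values
    on [C] matter. *)
Record unital_star_hom_on (R : realType) (A M : cstarType R) (C : set A)
    (pi : A -> M) : Prop := {
  star_hom1 : pi 1 = 1 ;
  star_homD : forall x y, C x -> C y -> pi (x + y) = pi x + pi y ;
  star_homZ : forall (k : R[i]) x, C x -> pi (k *: x) = k *: pi x ;
  star_homM : forall x y, C x -> C y -> pi (x * y) = pi x * pi y ;
  star_hom_star : forall x, C x -> pi (star x) = star (pi x)
}.

Section VonNeumann.
Variables (R : realType) (H : completeNormedModType R[i])
  (form : {dot H for Num.conj}).

(** Together with completeness, this makes [H] a Hilbert space. *)
Definition norm_of_inner_product : Prop :=
  forall x : H, `|x| ^+ 2 = form x x.

Definition adjoint_of (S T : {linear H -> H}) : Prop :=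
  forall x y : H, form (S x) y = form x (T y).

Definition commutant (S : set {linear H -> H}) : set {linear H -> H} :=
  [set T | bounded_map T /\ forall U, S U -> forall x, T (U x) = U (T x)].

(** A set equal to its bicommutant is automatically a unital subalgebra of the
    bounded operators. *)
Definition von_neumann_algebra_on (S : set {linear H -> H}) : Prop :=
  [/\ forall T, S T -> bounded_map T,
      forall T, S T -> exists2 T', S T' & adjoint_of T T' &
      commutant (commutant S) = S].

Record star_representation (M : cstarType R) (rho : M -> {linear H -> H}) :
    Prop := {
  star_rep1 : forall h, rho 1 h = h ;
  star_repD : forall x y h, rho (x + y) h = rho x h + rho y h ;
  star_repZ : forall (k : R[i]) x h, rho (k *: x) h = k *: rho x h ;
  star_repM : forall x y h, rho (x * y) h = rho x (rho y h) ;
  star_rep_star : forall x, adjoint_of (rho x) (rho (star x))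
}.

End VonNeumann.

(** [M] is *-isomorphic to a von Neumann algebra of operators on a Hilbert space;
    such an isomorphism is automatically isometric. *)
Definition von_neumann_algebra (R : realType) (M : cstarType R) : Prop :=
  exists (H : completeNormedModType R[i]) (form : {dot H for Num.conj})
    (rho : M -> {linear H -> H}),
    [/\ norm_of_inner_product form, star_representation form rho,
        injective rho & von_neumann_algebra_on form (range rho)].

Definition mxstar (R : realType) (A : cstarType R) (n : nat) (X : 'M[A]_n) :
  'M[A]_n := map_mx star X^T.

(** Positivity in the C*-algebra of n x n matrices over [A]. *)
Definition mxpositive (R : realType) (A : cstarType R) (n : nat)
  (X : 'M[A]_n) : Prop :=
  exists Y : 'M[A]_n, X = mxstar Y *m Y.

Definition completely_positive (R : realType) (A M : cstarType R)
  (v : {linear A -> M}) : Prop :=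
  forall (n : nat) (X : 'M[A]_n), mxpositive X -> mxpositive (map_mx v X).

Definition decomposable (R : realType) (A M : cstarType R)
  (u : {linear A -> M}) : Prop :=
  exists v1 v2 v3 v4 : {linear A -> M},
    [/\ completely_positive v1, completely_positive v2,
        completely_positive v3, completely_positive v4 &
        forall a, u a = (v1 a - v2 a) + 'i *: (v3 a - v4 a)].

Definition bimodule_map (R : realType) (A M : cstarType R) (C : set A)
  (pi : A -> M) (u : {linear A -> M}) : Prop :=
  bounded_map u /\
  forall c1 a c2, C c1 -> C c2 -> u (c1 * a * c2) = pi c1 * u a * pi c2.

Definition cp_extension (R : realType) (A M : cstarType R) (C : set A)
  (pi : A -> M) (pihat : {linear A -> M}) : Prop :=
  completely_positive pihat /\ forall c, C c -> pihat c = pi c.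

(* Main.v *)
Require Import Defs.
From HB Require Import structures.
From mathcomp Require Import all_boot all_order all_algebra.
From mathcomp Require Import complex.
From mathcomp Require Import all_classical all_reals all_analysis.
From mathcomp Require Import ring lra.
Import Order.TTheory GRing.Theory Num.Theory.
Import numFieldNormedType.Exports.
Import Normc.
Local Open Scope classical_set_scope.
Local Open Scope complex_scope.
Local Open Scope ring_scope.

(** Let [v1 - v2] be one of the two selfadjoint differences in the decomposition
    of [u]. Completely positive maps commute with the involution, so the
    differences are the real and imaginary parts of [u]; since [pi] is a
    *-homomorphism, each of them is again a bimodule map. It thus suffices to
    decompose a bimodule map [d = v1 - v2] ([bimodule_difference]).

    Put [v = v1 + v2], so that [v + d] and [v - d] are completely positive, and
    represent [M] on a Hilbert space [H] as a von Neumann algebra. Let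
    [v a = V^* s(a) V] be the Stinespring dilation of [v] on the completion [K] of
    the tensors [A (x) H]. The closed span [N] of the vectors
    [a c (x) h - a (x) pi(c) h], with [c] in [C], is invariant under [s(A)], so
    the projection [Q] onto its orthogonal complement commutes with [s(A)], and
    [w a = V^* Q s(a) Q V] is completely positive. Moreover:
    - [w] satisfies [w (a c) = w a * pi c], since [Q] kills [N]; taking adjoints,
      it is a bimodule map;
    - [w] takes its values in [M]: the commutant of [M] acts on the second tensor
      factor and, together with its adjoints, preserves [N], so that [w a] is in
      the bicommutant;
    - [w + d] and [w - d] are completely positive: the form
      [(a (x) h, b (x) k) |-> (d (b^* a) h, k)] of [d] vanishes on [N] because [d]
      is a bimodule map, hence its value at a vector [x] equals the value at
      [Q x], where it is dominated by the form of [v], that is, by the form of [w]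
      at [x].
    Then [d = (w + d) / 2 - (w - d) / 2].

    The completion [K] is avoided: tensors are lists of pairs carrying a
    semi-inner product, and [V^* Q] takes values in the complete space [H], where
    it is the limit over approximate projections ([proj_image]). These exist by
    near-minimization of a quadratic functional ([approx_riesz]), which also
    yields adjoints of operators.

    The passage between positive forms and positive matrices over [M] requires
    square roots of positive elements. They come from one iteration
    ([sqrt_one_minus]), run both in a C*-algebra, with its norm, and in the
    matrices over [M], with strong operator limits ([mxpositive_of_form]). The
    first use shows that [A] acts on the tensors by bounded operators. The second
    one also writes selfadjoint operators as real parts of unitaries, which
    compares the norm of [M] with the operator norm ([rnorm_le_operator]) and
    makes the maps bounded. *)

Set Implicit Arguments.
Unset Strict Implicit.
Unset Printing Implicit Defensive.

Local Notation Re := complex.Re.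
Local Notation Im := complex.Im.

(** * Real-valued norms *)

Section RealNorm.
Variable R : realType.
Implicit Types (z : R[i]).

Lemma normc_ge0 z : 0 <= normc z.
Proof. by case: z => a b; apply: sqrtr_ge0. Qed.

Lemma normrE_normc z : `|z| = (normc z)%:C.
Proof. by []. Qed.

Lemma normc_real (k : R) : normc k%:C = `|k|.
Proof. by rewrite /= expr0n addr0 sqrtr_sqr. Qed.

Lemma conj_real (k : R) : (k%:C)^* = k%:C.
Proof. exact: conjc_real. Qed.

Lemma mul_conjc z : z * z^* = (normc z ^+ 2)%:C.
Proof. by rewrite rmorphXn /= -normCK normrE_normc. Qed.

Lemma ler_Re_normc z : Re z <= normc z.
Proof.
case: z => a b /=; apply: (le_trans (ler_norm a)).
by rewrite -sqrtr_sqr ler_wsqrtr // lerDl sqr_ge0.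
Qed.

Lemma ler_Im_normc z : `|Im z| <= normc z.
Proof. by case: z => a b /=; rewrite -sqrtr_sqr ler_wsqrtr // lerDr sqr_ge0. Qed.

Lemma Re_real_mul (k : R) z : Re (k%:C * z) = k * Re z.
Proof. by case: z => a b /=; rewrite mul0r subr0. Qed.

Lemma complex_ge0 z : (0 <= z) = (Im z == 0) && (0 <= Re z).
Proof. by rewrite lecE. Qed.

Lemma normc_eq0 z : normc z = 0 -> z = 0. Proof. exact: eq0_normc. Qed.

Lemma ler_eps (x y : R) : (forall e : R, 0 < e -> x <= y + e) -> x <= y.
Proof. by move=> h; apply/ler_addgt0Pr => e /h. Qed.

Lemma inv_succ_small (e : R) : 0 < e ->
  exists N : nat, forall k, (N <= k)%N -> k.+1%:R^-1 <= e.
Proof.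
move=> e0; exists (Num.truncn e^-1) => k Nk.
rewrite -[e]invrK lef_pV2 ?posrE ?invr_gt0 ?ltr0Sn //.
by apply: (le_trans (ltW (truncnS_gt _))); rewrite ler_nat ltnS.
Qed.

(** The imaginary part and the negative part of the real part are bounded by the
    distance to every point of the half-line. *)
Lemma ge0_approx z :
  (forall e : R, 0 < e -> exists2 y, 0 <= y & normc (z - y) <= e) -> 0 <= z.
Proof.
move=> h; rewrite complex_ge0; apply/andP; split.
  rewrite -normr_le0; apply: ler_eps => e /h[y y0 yz].
  have Imy : Im y = 0 by apply: ger0_Im.
  rewrite add0r; apply: le_trans yz.
  by have := ler_Im_normc (z - y); rewrite raddfB /= Imy subr0.
apply: ler_eps => e /h[y y0 yz].
have Rey : 0 <= Re y by move: y0; rewrite complex_ge0 => /andP[].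
have := ler_Re_normc (y - z); rewrite -normcN opprB raddfB /=.
lra.
Qed.

(** Evaluate at [t = 1 / q]; when [q = 0], a large [t] forces [g = 0]. This is the
    common core of the Cauchy-Schwarz inequality and of approximate minimization. *)
Lemma quadratic_ge0 (d g q : R) : 0 <= g -> 0 <= q ->
  (forall t, 0 <= t -> 0 <= d - 2 * t * g + t ^+ 2 * g * q) -> g <= d * q.
Proof.
move=> g0 q0 h.
have d0 : 0 <= d by have := h 0 (lexx 0); rewrite !(mulr0, mul0r) subr0 expr0n !mul0r addr0.
have [q_eq0|qN0] := eqVneq q 0.
  rewrite q_eq0 mulr0.
  have [//|gp] := leP g 0.
  have t0 : 0 <= (d + 1) / g by apply: divr_ge0; lra.
  have := h _ t0; rewrite q_eq0 mulr0 addr0.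
  have -> : 2 * ((d + 1) / g) * g = 2 * (d + 1) by field; rewrite gt_eqF.
  lra.
have qp : 0 < q by rewrite lt_def qN0.
have := h q^-1 (ltW _); rewrite invr_gt0 => /(_ qp) h'.
have : 0 <= (d - 2 * q^-1 * g + q^-1 ^+ 2 * g * q) * q by rewrite mulr_ge0.
have -> : (d - 2 * q^-1 * g + q^-1 ^+ 2 * g * q) * q = d * q - g by field.
by rewrite subr_ge0.
Qed.

Section NormedModule.
Variable V : normedModType R[i].
Implicit Types x y : V.

Definition rnorm x : R := Re `|x|.

Lemma rnormE x : `|x| = (rnorm x)%:C.
Proof. by rewrite /rnorm RRe_real // normr_real. Qed.

Lemma rnorm_ge0 x : 0 <= rnorm x.
Proof. by rewrite -ler0c -rnormE normr_ge0. Qed.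

Lemma rnorm_eq0 x : rnorm x = 0 -> x = 0.
Proof. by move=> h; apply/normr0_eq0; rewrite rnormE h. Qed.

Lemma rnorm0 : rnorm 0 = 0. Proof. by rewrite /rnorm normr0. Qed.

Lemma rnormD x y : rnorm (x + y) <= rnorm x + rnorm y.
Proof. by rewrite -lecR rmorphD /= -!rnormE ler_normD. Qed.

Lemma rnormZ k x : rnorm (k *: x) = normc k * rnorm x.
Proof. by apply: complexI; rewrite rmorphM /= -rnormE normrZ -rnormE. Qed.

Lemma rnormN x : rnorm (- x) = rnorm x.
Proof. by rewrite /rnorm normrN. Qed.

Lemma rnormB x y : rnorm (x - y) <= rnorm x + rnorm y.
Proof. by rewrite -[rnorm y]rnormN rnormD. Qed.

Lemma rnorm_distC x y : rnorm (x - y) = rnorm (y - x).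
Proof. by rewrite -rnormN opprB. Qed.

Lemma rnorm_eps x : (forall e : R, 0 < e -> rnorm x <= e) -> x = 0.
Proof.
move=> h; apply: rnorm_eq0; apply/eqP; rewrite eq_le rnorm_ge0 andbT.
by apply: ler_eps => e /h; rewrite add0r.
Qed.

End NormedModule.

Lemma bounded_mapP (V W : normedModType R[i]) (f : V -> W) :
  bounded_map f <-> exists2 k : R, 0 <= k & forall x, rnorm (f x) <= k * rnorm x.
Proof.
split=> [[k hk]|[k k0 hk]]; last first.
  by exists k%:C => x; rewrite !rnormE -rmorphM lecR.
exists (normc k) => [|x]; first exact: normc_ge0.
have := hk x; rewrite !rnormE lecE => /andP[_ /=]; rewrite mulrC Re_real_mul mulrC.
move=> /le_trans -> //; rewrite ler_wpM2r ?rnorm_ge0 //.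
by apply: ler_Re_normc.
Qed.

Lemma rnorm_complete (V : completeNormedModType R[i]) (x : nat -> V) :
  (forall e : R, 0 < e -> exists N, forall m n, (N <= m)%N -> (N <= n)%N ->
     rnorm (x m - x n) <= e) ->
  exists l, forall e : R, 0 < e -> exists N, forall n, (N <= n)%N ->
     rnorm (l - x n) <= e.
Proof.
move=> cx.
have cvx : cvg (x @ \oo).
  apply/cauchy_cvgP/cauchy_exP => e e0.
  have er : e = (Re e)%:C by rewrite RRe_real // gtr0_real.
  have e0' : 0 < Re e by rewrite -ltcR -er.
  have [N hN] := cx (Re e / 2) (divr_gt0 e0' (ltr0Sn _ 1)).
  exists (x N); exists N => // n /= Nn.
  rewrite -ball_normE /ball_ /= rnormE er ltcR.
  apply: le_lt_trans (hN _ _ (leqnn _) Nn) _; lra.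
exists (lim (x @ \oo)) => e e0.
have e0' : 0 < e%:C by rewrite ltcR.
have /cvgrPdist_le/(_ _ e0')[N _ hN] := cvx.
by exists N => n Nn; rewrite -lecR -rnormE; apply: hN.
Qed.

End RealNorm.

(** * Semi-inner products *)

Section SemiInner.
Variables (R : realType) (X : Type).
Variables (add : X -> X -> X) (scl : R[i] -> X -> X) (B : X -> X -> R[i]).

(** Only the values of the form are constrained: [X] may be a set of formal sums
    on which [add] and [scl] obey no module law. *)
Record semi_inner : Prop := {
  si_Dl : forall x y z, B (add x y) z = B x z + B y z ;
  si_Zl : forall k x z, B (scl k x) z = k * B x z ;
  si_herm : forall x y, B y x = (B x y)^* ;
  si_ge0 : forall x, 0 <= B x x
}.

Definition snorm (x : X) : R := Num.sqrt (Re (B x x)).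

Hypothesis siB : semi_inner.
Implicit Types x y z n : X.

Lemma si_Dr x y z : B z (add x y) = B z x + B z y.
Proof.
by rewrite (si_herm siB) (si_Dl siB) rmorphD /= -!(si_herm siB).
Qed.

Lemma si_Zr k x z : B z (scl k x) = k^* * B z x.
Proof.
by rewrite (si_herm siB) (si_Zl siB) rmorphM /= -!(si_herm siB).
Qed.

Lemma snorm_ge0 x : 0 <= snorm x.
Proof. exact: sqrtr_ge0. Qed.

Lemma snorm_sqr x : snorm x ^+ 2 = Re (B x x).
Proof.
by rewrite sqr_sqrtr //; have := si_ge0 siB x; rewrite complex_ge0 => /andP[].
Qed.

Lemma si_diag x : B x x = (snorm x ^+ 2)%:C.
Proof. by rewrite snorm_sqr RRe_real // ger0_real // si_ge0. Qed.

Lemma snorm_le x (c : R) : 0 <= c -> Re (B x x) <= c ^+ 2 -> snorm x <= c.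
Proof. by move=> c0 h; rewrite -(ler_pXn2r (ltn0Sn 1)) ?nnegrE ?snorm_ge0 // snorm_sqr. Qed.

Lemma si_expand (t : R) (g : R[i]) x y :
  Re (B (add x (scl (- (t%:C * g)) y)) (add x (scl (- (t%:C * g)) y))) =
  snorm x ^+ 2 - 2 * t * Re (g^* * B x y) + t ^+ 2 * normc g ^+ 2 * snorm y ^+ 2.
Proof.
rewrite !(si_Dl siB, si_Dr, si_Zl siB, si_Zr) (si_herm siB x y) !si_diag.
have -> : normc g ^+ 2 = Re g ^+ 2 + Im g ^+ 2.
  by case: g => a b; rewrite /= sqr_sqrtr // addr_ge0 ?sqr_ge0.
case: (B x y) => c d; case: g => a b /=; ring.
Qed.

Lemma Cauchy_Schwarz x y : normc (B x y) <= snorm x * snorm y.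
Proof.
rewrite -(ler_pXn2r (ltn0Sn 1)) ?nnegrE ?mulr_ge0 ?snorm_ge0 ?normc_ge0 //.
rewrite exprMn; apply: quadratic_ge0 => [||t t0]; rewrite ?sqr_ge0 //.
have := si_ge0 siB (add x (scl (- (t%:C * B x y)) y)).
rewrite complex_ge0 => /andP[_]; rewrite si_expand.
by have -> : Re ((B x y)^* * B x y) = normc (B x y) ^+ 2 by rewrite mulrC mul_conjc.
Qed.

Lemma snormD x y : snorm (add x y) <= snorm x + snorm y.
Proof.
apply: snorm_le; first by rewrite addr_ge0 ?snorm_ge0.
rewrite !(si_Dl siB, si_Dr) (si_herm siB x y) !si_diag !raddfD /=.
have h := le_trans (ler_Re_normc _) (Cauchy_Schwarz x y).
have -> : Re (B x y)^* = Re (B x y) by case: (B x y).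
nra.
Qed.

(** Approximate Riesz representation on a subspace [N] of an incomplete space:
    nearly minimize [snorm n ^+ 2 - 2 * Re (f n)]. Along every line through a
    near-minimizer this functional is a quadratic polynomial, whose discriminant
    bounds the error. *)
Lemma approx_riesz (N : X -> Prop) (f : X -> R[i]) (c e : R) :
  (exists n, N n) -> (forall x y, N x -> N y -> N (add x y)) ->
  (forall k x, N x -> N (scl k x)) ->
  (forall x y, f (add x y) = f x + f y) ->
  (forall k x, f (scl k x) = k^* * f x) ->
  (forall n, N n -> normc (f n) <= c * snorm n) -> 0 < e ->
  exists2 m, N m & forall n, N n -> normc (B m n - f n) <= e * snorm n.
Proof.
move=> [n1 Nn1] ND NZ fD fZ fc e0.
pose J n := snorm n ^+ 2 - 2 * Re (f n).
pose E := [set J n | n in [set n | N n]].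
have lbE : lbound E (- c ^+ 2).
  move=> _ [n Nn <-]; rewrite /J.
  have h := le_trans (ler_Re_normc _) (fc n Nn).
  have := sqr_ge0 (snorm n - c); lra.
have hiE : has_inf E by split; [exists (J n1), n1 | exists (- c ^+ 2)].
have [_ [m Nm <-] Jm] := inf_adherent (exprn_gt0 2 e0) hiE.
exists m => // n Nn; set g := B m n - f n.
rewrite -(ler_pXn2r (ltn0Sn 1)) ?nnegrE ?mulr_ge0 ?snorm_ge0 ?normc_ge0 ?(ltW e0) //.
rewrite exprMn; apply: quadratic_ge0 => [||t t0]; rewrite ?sqr_ge0 //.
pose m' := add m (scl (- (t%:C * g)) n).
have Jm' : inf E <= J m'.
  by apply: ge_inf; [exists (- c ^+ 2) | exists m' => //; apply: ND => //; apply: NZ].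
have : J m' = J m - 2 * t * normc g ^+ 2 + t ^+ 2 * normc g ^+ 2 * snorm n ^+ 2.
  rewrite /J snorm_sqr si_expand fD fZ.
  have -> : B m n = g + f n by rewrite /g subrK.
  have -> : normc g ^+ 2 = Re g ^+ 2 + Im g ^+ 2.
    by case: (g) => a b; rewrite /= sqr_sqrtr // addr_ge0 ?sqr_ge0.
  by case: (f n) => c' d; case: (f m) => c'' d'; case: (g) => a b /=; ring.
lra.
Qed.

End SemiInner.

(** * Images of orthogonal projections in incomplete spaces *)

Section Projection.
Variables (R : realType) (X : Type).
Variables (add : X -> X -> X) (scl : R[i] -> X -> X) (B : X -> X -> R[i]).
Hypothesis siB : semi_inner add scl B.
Variable N : X -> Prop.
Hypothesis N_ex : exists n, N n.
Hypothesis N_add : forall x y, N x -> N y -> N (add x y).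
Hypothesis N_scl : forall k x, N x -> N (scl k x).
Variables (H : completeNormedModType R[i]) (Phi : X -> H) (K : R).
Hypothesis K_ge0 : 0 <= K.
Hypothesis Phi_add : forall x y, Phi (add x y) = Phi x + Phi y.
Hypothesis Phi_scl : forall k x, Phi (scl k x) = k *: Phi x.
Hypothesis Phi_bounded : forall x, rnorm (Phi x) <= K * snorm B x.
Local Notation p := (snorm B).

(** As [X] is not complete, the component of [x] orthogonal to [N] is only
    available through approximations [x + n], with error [e]. *)
Definition almost_orthogonal (e : R) (x n : X) : Prop :=
  N n /\ forall m, N m -> normc (B x m + B n m) <= e * p m.

Lemma almost_orthogonal_ex (e : R) x : 0 < e -> exists n, almost_orthogonal e x n.
Proof.
move=> e0.
have [||m|n Nn hn] := @approx_riesz _ _ _ _ _ siB N (fun m => - B x m) (p x) e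
  N_ex N_add N_scl _ _ _ e0.
- by move=> y z; rewrite (si_Dr siB) opprD.
- by move=> k y; rewrite (si_Zr siB) mulrN.
- by move=> _; rewrite normcN (Cauchy_Schwarz siB).
by exists n; split=> // m /hn; rewrite opprK addrC.
Qed.

(** The difference of two approximations lies in [N] and is almost orthogonal to
    [N], in particular to itself. *)
Lemma almost_orthogonal_unique (e e' : R) x n n' : 0 <= e -> 0 <= e' ->
  almost_orthogonal e x n -> almost_orthogonal e' x n' ->
  rnorm (Phi n - Phi n') <= K * (e + e').
Proof.
move=> e0 e'0 [Nn hn] [Nn' hn'].
pose m := add n (scl (-1) n').
have Nm : N m by apply: N_add => //; apply: N_scl.
have -> : Phi n - Phi n' = Phi m by rewrite Phi_add Phi_scl scaleN1r.
apply: le_trans (Phi_bounded _) _; rewrite ler_wpM2l //.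
have hm : p m ^+ 2 <= (e + e') * p m.
  rewrite (snorm_sqr siB) (le_trans (ler_Re_normc _)) //.
  have -> : B m m = (B x m + B n m) - (B x m + B n' m).
    by rewrite {1}/m (si_Dl siB) (si_Zl siB); ring.
  rewrite mulrDl (le_trans (le_normcD _ _)) //.
  by rewrite normcN lerD ?hn ?hn'.
have := snorm_ge0 B m; rewrite le_eqVlt => /orP[/eqP <-|pm]; first by rewrite addr_ge0.
by move: hm; rewrite expr2 ler_pM2r.
Qed.

Lemma proj_image_ex x : exists g : H, forall (e : R) n, 0 < e ->
  almost_orthogonal e x n -> rnorm (g - (Phi x + Phi n)) <= K * e.
Proof.
have inv_gt0 k : 0 < k.+1%:R^-1 :> R by rewrite invr_gt0 ltr0Sn.
have [n_ hn_] := choice (fun k : nat => almost_orthogonal_ex x (inv_gt0 k)).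
have inv_ge0 k : 0 <= k.+1%:R^-1 :> R by rewrite invr_ge0 ler0n.
have small (d : R) : 0 < d -> exists k0 : nat, forall k, (k0 <= k)%N -> K * k.+1%:R^-1 <= d.
  move=> d0; have [k0 hk0] : exists k0 : nat, K / d < k0%:R.
    by exists (Num.truncn (K / d)).+1; apply: truncnS_gt.
  exists k0 => k kk; rewrite ler_pdivrMr ?ltr0Sn //.
  move: hk0; rewrite ltr_pdivrMr // => /ltW/le_trans -> //.
  by rewrite mulrC ler_pM2l // ler_nat (leq_trans kk).
have [d d0|l hl] := @rnorm_complete R H (fun k => Phi x + Phi (n_ k)).
  have [k0 hk0] := small _ (divr_gt0 d0 (ltr0Sn _ 1)); exists k0 => i j ki kj.
  rewrite opprD addrACA subrr add0r.
  apply: le_trans (almost_orthogonal_unique _ _ (hn_ i) (hn_ j)) _ => //.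
  by rewrite mulrDr [leRHS]splitr lerD // hk0.
exists l => e n e0 hn; apply: ler_eps => d d0.
have [k1 hk1] := hl _ (divr_gt0 d0 (ltr0Sn _ 1)).
have [k0 hk0] := small _ (divr_gt0 d0 (ltr0Sn _ 1)).
pose k := maxn k0 k1.
have -> : l - (Phi x + Phi n) = (l - (Phi x + Phi (n_ k))) + (Phi (n_ k) - Phi n).
  by rewrite !opprD !addrA subrK.
apply: le_trans (rnormD _ _) _.
have h1 := hk1 k (leq_maxr _ _); have h0 := hk0 k (leq_maxl _ _).
have h2 := almost_orthogonal_unique (inv_ge0 k) (ltW e0) (hn_ k) hn.
rewrite mulrDr in h2; move: (K / _) h0 h2 => a h0 h2; lra.
Qed.

(** [Phi] applied to the component of [x] orthogonal to the closure of [N],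
    although this component need not lie in [X]. *)
Definition proj_image (x : X) : H := projT1 (cid (proj_image_ex x)).

Lemma proj_imageP e x n : 0 < e -> almost_orthogonal e x n ->
  rnorm (proj_image x - (Phi x + Phi n)) <= K * e.
Proof. exact: projT2 (cid (proj_image_ex x)) e n. Qed.

Lemma proj_image_unique (L : R) x g : 0 < L ->
  (forall e : R, 0 < e -> exists2 n, almost_orthogonal (L * e) x n &
      rnorm (g - (Phi x + Phi n)) <= L * e) -> g = proj_image x.
Proof.
move=> L0 h; apply/eqP; rewrite -subr_eq0; apply/eqP/rnorm_eps => e e0.
have LK : 0 < L + K * L by rewrite ltr_wpDr // mulr_ge0 // ltW.
have [n hn gn] := h (e / (L + K * L)) (divr_gt0 e0 LK).
have := proj_imageP (mulr_gt0 L0 (divr_gt0 e0 LK)) hn.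
have -> : g - proj_image x = (g - (Phi x + Phi n)) - (proj_image x - (Phi x + Phi n)).
  by rewrite opprB addrA subrK.
move=> h1; apply: le_trans (rnormB _ _) _; apply: (le_trans (lerD gn h1)).
have LKn : L + K * L != 0 by rewrite gt_eqF.
by have -> : L * (e / (L + K * L)) + K * (L * (e / (L + K * L))) = e by field.
Qed.

Lemma proj_image_ext x y : (forall m, B x m = B y m) -> Phi x = Phi y ->
  proj_image x = proj_image y.
Proof.
move=> Bxy Pxy; apply: (@proj_image_unique (1 + K)) => [|e e0]; first by rewrite ltr_pwDl.
have [n [Nn hn]] := almost_orthogonal_ex x e0.
have eL : e <= (1 + K) * e by rewrite ler_peMl ?lerDl // ltW.
exists n; first split=> // m Nm.
  by rewrite -Bxy; apply: le_trans (hn _ Nm) _; rewrite ler_wpM2r ?snorm_ge0.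
rewrite -Pxy; apply: le_trans (proj_imageP e0 (conj Nn hn)) _.
by rewrite ler_wpM2r ?(ltW e0) // lerDr.
Qed.

Lemma proj_imageD x y : proj_image (add x y) = proj_image x + proj_image y.
Proof.
apply/esym/(@proj_image_unique (2 + 2 * K)) => [|e e0].
  by rewrite ltr_pwDl // mulr_ge0.
have [n [Nn hn]] := almost_orthogonal_ex x e0.
have [m [Nm hm]] := almost_orthogonal_ex y e0.
have Ke : 0 <= K * e by rewrite mulr_ge0 // ltW.
exists (add n m); first split=> [|n' Nn']; first exact: N_add.
  rewrite !(si_Dl siB) addrACA (le_trans (le_normcD _ _)) //.
  have := hn _ Nn'; have := hm _ Nn'; have := snorm_ge0 B n'; nra.
rewrite !Phi_add addrACA opprD addrACA (le_trans (rnormD _ _)) //.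
have := proj_imageP e0 (conj Nn hn); have := proj_imageP e0 (conj Nm hm).
lra.
Qed.

Lemma proj_imageZ k x : proj_image (scl k x) = k *: proj_image x.
Proof.
apply/esym/(@proj_image_unique (normc k + 1 + normc k * K)) => [|e e0].
  by rewrite ltr_wpDr ?ltr_wpDl ?mulr_ge0 ?normc_ge0.
have [n [Nn hn]] := almost_orthogonal_ex x e0.
have k0 := normc_ge0 k.
have Ke : 0 <= K * e by rewrite mulr_ge0 // ltW.
have kKe : 0 <= normc k * (K * e) by rewrite mulr_ge0.
exists (scl k n); first split=> [|m Nm]; first exact: N_scl.
  rewrite !(si_Zl siB) -mulrDr normcM.
  have h := ler_wpM2l k0 (hn _ Nm).
  have : 0 <= e * p m + normc k * K * e * p m.
    by rewrite addr_ge0 ?mulr_ge0 ?snorm_ge0 // ltW.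
  lra.
rewrite !Phi_scl -scalerDr -scalerBr rnormZ.
have h := ler_wpM2l k0 (proj_imageP e0 (conj Nn hn)).
have : 0 <= normc k * e by rewrite mulr_ge0 // ltW.
lra.
Qed.

Lemma proj_image_N x : N x -> proj_image x = 0.
Proof.
move=> Nx; apply/esym/(@proj_image_unique 1) => // e e0.
exists (scl (-1) x); first split=> [|m Nm]; first exact: N_scl.
  rewrite (si_Zl siB) mulN1r subrr normc0 mul1r.
  by rewrite mulr_ge0 ?snorm_ge0 // ltW.
by rewrite Phi_scl scaleN1r subrr subr0 rnorm0 mul1r ltW.
Qed.

Lemma almost_orthogonal_snorm e x n : 0 <= e -> almost_orthogonal e x n ->
  p n <= p x + e.
Proof.
move=> e0 [Nn /(_ n Nn) hn].
have := Cauchy_Schwarz siB x n.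
have : p n ^+ 2 <= normc (B x n + B n n) + normc (B x n).
  rewrite (snorm_sqr siB) (le_trans (ler_Re_normc _)) //.
  rewrite -[in leLHS](addKr (B x n) (B n n)) addrC (le_trans (le_normcD _ _)) //.
  by rewrite normcN.
have := snorm_ge0 B n; rewrite le_eqVlt => /orP[/eqP <- _ _|pn].
  by rewrite addr_ge0 ?snorm_ge0.
move=> h1 h2; have {h1 h2}h3 : p n * p n <= (p x + e) * p n by lra.
by rewrite -(ler_pM2r pn).
Qed.

Lemma proj_image_bounded x : rnorm (proj_image x) <= 2 * K * p x.
Proof.
apply: ler_eps => d d0.
have e0 : 0 < d / (1 + 2 * K) by rewrite divr_gt0 // ltr_pwDl // mulr_ge0.
have [n hn] := almost_orthogonal_ex x e0.
set e := d / _ in e0 hn.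
have de : d = e + 2 * (K * e).
  rewrite /e; field; rewrite gt_eqF // ltr_pwDl // mulr_ge0 //.
have h1 := proj_imageP e0 hn.
have h2 := ler_wpM2l K_ge0 (almost_orthogonal_snorm (ltW e0) hn).
have h3 := Phi_bounded x; have h4 := Phi_bounded n.
rewrite -[proj_image x](subrK (Phi x + Phi n)).
apply: le_trans (rnormD _ _) _.
have := rnormD (Phi x) (Phi n).
lra.
Qed.

Section Intertwining.
Variables (T T' : X -> X) (c : R).
Hypothesis c_gt0 : 0 < c.
Hypothesis BT : forall x y, B (T x) y = B x (T' y).
Hypothesis NT : forall n, N n -> N (T n).
Hypothesis NT' : forall n, N n -> N (T' n).
Hypothesis T'_bounded : forall x, p (T' x) <= c * p x.

Lemma almost_orthogonal_adjoint e x n : 0 < e ->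
  almost_orthogonal e x n -> almost_orthogonal (c * e) (T x) (T n).
Proof.
move=> e0 [Nn hn]; split=> [|m Nm]; first exact: NT.
rewrite !BT (le_trans (hn _ (NT' Nm))) //.
by rewrite [c * e]mulrC -mulrA ler_wpM2l // ltW.
Qed.

(** [T] and its adjoint preserve [N], hence [T] commutes with the orthogonal
    projection. *)
Lemma proj_image_intertwine (S : H -> H) (s : R) : 0 <= s ->
  (forall x, Phi (T x) = S (Phi x)) -> (forall h k, S (h + k) = S h + S k) ->
  (forall h k, S (h - k) = S h - S k) ->
  (forall h, rnorm (S h) <= s * rnorm h) ->
  forall x, proj_image (T x) = S (proj_image x).
Proof.
move=> s0 PT SD SB Sb x.
have sK : 0 <= s * K by rewrite mulr_ge0.
apply/esym/(@proj_image_unique (c + s * K)) => [|e e0]; first by rewrite ltr_pwDl.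
have [n hn] := almost_orthogonal_ex x e0.
have sKe : 0 <= s * K * e by rewrite mulr_ge0 // ltW.
exists (T n).
  have [NTn hTn] := almost_orthogonal_adjoint e0 hn; split=> // m Nm.
  apply: le_trans (hTn _ Nm) _.
  by rewrite ler_wpM2r ?snorm_ge0 // mulrDl lerDl.
rewrite !PT -SD -SB (le_trans (Sb _)) //.
have h := ler_wpM2l s0 (proj_imageP e0 hn).
have : 0 <= c * e by rewrite mulr_ge0 // ltW.
lra.
Qed.

End Intertwining.
End Projection.

(** * Square roots by fixed-point iteration *)

Section SquareRoot.
Variables (R : realType) (S : pzRingType) (st : S -> S) (bnd : S -> R -> Prop).

(** [bnd x t] reads as: the norm of [x] is at most [t]. The relational form covers
    both the norm of a C*-algebra and the operator norm of a matrix algebra acting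
    on [H ^ n], where a supremum would have to be formed; in the latter case
    [bnd_complete] asserts convergence in the strong operator topology together
    with the rate in norm. *)
Record star_bounds : Prop := {
  stD : forall x y, st (x + y) = st x + st y ;
  stM : forall x y, st (x * y) = st y * st x ;
  stK : forall x, st (st x) = x ;
  bnd_mono : forall x s t, s <= t -> bnd x s -> bnd x t ;
  bnd0 : bnd 0 0 ;
  bndN : forall x t, bnd x t -> bnd (- x) t ;
  bndD : forall x y s t, bnd x s -> bnd y t -> bnd (x + y) (s + t) ;
  bndM : forall x y s t, bnd x s -> bnd y t -> bnd (x * y) (s * t) ;
  bnd_st : forall x t, bnd x t -> bnd (st x) t ;
  bnd_separated : forall x, (forall e : R, 0 < e -> bnd x e) -> x = 0 ;
  bnd_complete : forall y : nat -> S,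
    (forall k m, (k <= m)%N -> bnd (y m - y k) k.+2%:R^-1) ->
    exists l, forall k, bnd (l - y k) k.+2%:R^-1
}.

Hypothesis sb : star_bounds.

Lemma st0 : st 0 = 0.
Proof. by apply: (addrI (st 0)); rewrite -(stD sb) !addr0. Qed.

Lemma st1 : st 1 = 1.
Proof. by rewrite -[LHS]mul1r -{1}(stK sb 1) -(stM sb) mul1r (stK sb). Qed.

Lemma stN x : st (- x) = - st x.
Proof. by apply: (addrI (st x)); rewrite -(stD sb) !subrr st0. Qed.

Lemma stB x y : st (x - y) = st x - st y.
Proof. by rewrite (stD sb) stN. Qed.

Lemma bndB x y s t : bnd x s -> bnd y t -> bnd (x - y) (s + t).
Proof. by move=> bx /(bndN sb); apply: (bndD sb). Qed.

(** Scalar model of the iteration in [sqrt_one_minus]: it increases to its double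
    fixed point [1 / 2], and its increments dominate those of the iteration in
    [S]. *)
Fixpoint quarter_iter (k : nat) : R :=
  if k is k'.+1 then 1 / 4 + quarter_iter k' ^+ 2 else 0.

Lemma quarter_iter_bound k :
  0 <= quarter_iter k /\ 0 <= 1 / 2 - quarter_iter k <= k.+2%:R^-1.
Proof.
elim: k => [|k [IH0 /andP[IH1 IH2]]] /=; first by split=> //; apply/andP; split; lra.
set t := quarter_iter k in IH0 IH1 IH2 *.
split; first by rewrite addr_ge0 ?sqr_ge0 // divr_ge0.
have -> : 1 / 2 - (1 / 4 + t ^+ 2) = (1 / 2 - t) * (1 / 2 + t) by field.
have t2 : 0 <= 1 / 2 + t by lra.
rewrite (mulr_ge0 IH1 t2) /=; set s := 1 / 2 - t in IH1 IH2 *.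
have -> : 1 / 2 + t = 1 - s by rewrite /s; field.
have k0 : 0 <= k%:R :> R by rewrite ler0n.
have -> : k.+3%:R = 3 + k%:R :> R by rewrite -natrD.
have : s <= (2 + k%:R)^-1 by rewrite -natrD.
move: (k%:R) k0 => q q0 sq.
have q2 : 0 < 2 + q by lra.
have q3 : 0 < 3 + q by lra.
rewrite -[leRHS]mul1r ler_pdivlMr //.
have {}sq : s * (2 + q) <= 1 by rewrite -ler_pdivlMr // mul1r.
have hs : 0 <= s <= 1 / 2 by rewrite IH1 /s; lra.
(* [s (1 - s) (3 + q) <= (1 - s) (1 + s)] since [s (2 + q) <= 1] *)
have : s * (3 + q) <= 1 + s by lra.
move: hs => /andP[hs0 hs1] h; nra.
Qed.

(** The iterates of [y := x + y ^ 2] are polynomials in [x], hence commute with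
    each other; factoring [y' ^ 2 - y ^ 2 = (y' - y) (y' + y)] bounds their
    increments by those of the scalar model. A fixed point [y] satisfies
    [(1 - 2 y) ^ 2 = 1 - 4 x]. *)
Lemma sqrt_one_minus x : bnd x (1 / 4) -> st x = x ->
  exists z, [/\ st z = z, z * z = 1 - x *+ 4 &
    forall c t, bnd c t -> c * x = x * c -> c * z = z * c].
Proof.
move=> bx stx.
pose y := fix y k := if k is k'.+1 then x + y k' * y k' else 0.
pose t := quarter_iter.
have yE k : y k.+1 = x + y k * y k by [].
have tE k : t k.+1 = 1 / 4 + t k * t k by rewrite /t /= expr2.
have y_comm c k : c * x = x * c -> c * y k = y k * c.
  move=> cx; elim: k => [|k IH]; first by rewrite mulr0 mul0r.
  by rewrite yE mulrDr mulrDl cx mulrA IH -mulrA IH mulrA.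
have by_ k : bnd (y k) (t k).
  elim: k => [|k IH]; first exact: (bnd0 sb).
  by rewrite yE tE; apply: (bndD sb) => //; apply: (bndM sb).
have sty k : st (y k) = y k.
  elim: k => [|k IH]; first exact: st0.
  by rewrite yE (stD sb) (stM sb) stx !IH.
have step k : bnd (y k.+1 - y k) (t k.+1 - t k).
  elim: k => [|k IH].
    by rewrite [y 0%N]/= [t 0%N]/= !subr0; apply: (by_ 1%N).
  have -> : y k.+2 - y k.+1 = (y k.+1 - y k) * (y k.+1 + y k).
    have yC : y k * y k.+1 = y k.+1 * y k by apply/y_comm/esym/y_comm.
    rewrite [y k.+2]yE {3}[y k.+1]yE opprD addrACA subrr add0r.
    move: (y k.+1) (y k) yC => a b yC.
    by rewrite mulrBl !mulrDr yC opprD addrA addrK.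
  have -> : t k.+2 - t k.+1 = (t k.+1 - t k) * (t k.+1 + t k).
    rewrite [t k.+2]tE {3}[t k.+1]tE; move: (t k.+1) (t k) => a b; ring.
  by apply: (bndM sb) => //; apply: (bndD sb).
have steps k m : (k <= m)%N -> bnd (y m - y k) (t m - t k).
  move/subnK <-; elim: (m - k)%N => [|n IH].
    by rewrite !subrr; apply: (bnd0 sb).
  rewrite addSn.
  have -> : y (n + k).+1 - y k = (y (n + k).+1 - y (n + k)%N) + (y (n + k)%N - y k).
    by rewrite addrA subrK.
  have -> : t (n + k).+1 - t k = (t (n + k).+1 - t (n + k)%N) + (t (n + k)%N - t k).
    by rewrite addrA subrK.
  exact: (bndD sb).
have [Y hY] : exists Y, forall k, bnd (Y - y k) k.+2%:R^-1.
  apply: (bnd_complete sb) => k m km; apply: (bnd_mono sb) (steps _ _ km).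
  have [_ /andP[h1 _]] := quarter_iter_bound m.
  have [_ /andP[_ h2]] := quarter_iter_bound k.
  by rewrite /t; move: (k.+2%:R^-1) h2 => c h2; lra.
have small (d e : R) : 0 <= d -> 0 < e -> exists k : nat, d * k.+2%:R^-1 <= e.
  move=> d0 e0; exists (Num.truncn (d / e)).
  rewrite ler_pdivrMr ?ltr0Sn // mulrC -ler_pdivrMr //.
  by apply: (le_trans (ltW (truncnS_gt _))); rewrite ler_nat.
have bY : bnd Y 1.
  rewrite -[Y](subrK (y 0%N)); apply: (bnd_mono sb) (bndD sb (hY 0%N) (by_ 0%N)).
  by rewrite /t /=; lra.
have YE : Y = x + Y * Y.
  apply/eqP; rewrite -subr_eq0; apply/eqP/(bnd_separated sb) => e e0.
  have [k hk] := small 3 e (ler0n _ _) e0.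
  have -> : Y - (x + Y * Y) =
      (Y - y k.+1) - ((Y - y k) * Y + y k * (Y - y k)).
    by rewrite yE mulrBl mulrBr addrA subrK opprB !opprD !addrA subrK.
  have hk1 : (k.+3%:R^-1 : R) <= k.+2%:R^-1.
    by rewrite lef_pV2 ?posrE ?ltr0Sn // ler_nat.
  apply: (bnd_mono sb) (bndB (hY k.+1) (bndD sb (bndM sb (hY k) bY) (bndM sb (by_ k) (hY k)))).
  have [t0 /andP[t1 _]] := quarter_iter_bound k.
  have s0 : 0 <= (k.+2%:R^-1 : R) by rewrite invr_ge0.
  move: hk hk1 s0; rewrite /t mulr1; move: (k.+2%:R^-1) (k.+3%:R^-1) => a b hk hk1 a0.
  nra.
have stY : st Y = Y.
  apply/eqP; rewrite -subr_eq0; apply/eqP/(bnd_separated sb) => e e0.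
  have [k hk] := small 2 e (ler0n _ _) e0.
  have -> : st Y - Y = st (Y - y k) - (Y - y k).
    by rewrite stB sty opprB addrA subrK.
  by apply: (bnd_mono sb) (bndB (bnd_st sb (hY k)) (hY k)); rewrite -mulr2n -[leLHS]mulr_natl.
exists (1 - Y *+ 2); split.
- by rewrite stB st1 mulr2n (stD sb) stY.
- have YY : Y * Y = Y - x by apply/eqP; rewrite eq_sym subr_eq addrC -YE.
  rewrite mulrBl mul1r mulrBr mulr1 mulrnAl mulrnAr -mulrnA YY mulrnBl opprB.
  have -> : Y *+ 4 = Y *+ 2 + Y *+ 2 by rewrite -mulrnDr.
  by rewrite [_ - x *+ 4 - _]addrAC addrK addrA subrK.
- move=> c s bc cx; rewrite mulrBr mulrBl mulr1 mul1r mulrnAr mulrnAl.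
  congr (_ - _ *+ _); apply/eqP; rewrite -subr_eq0; apply/eqP/(bnd_separated sb) => e e0.
  have [k hk] := small (2 * `|s|) e (mulr_ge0 (ler0n _ _) (normr_ge0 _)) e0.
  have -> : c * Y - Y * c = c * (Y - y k) - (Y - y k) * c.
    by rewrite mulrBr mulrBl (y_comm c) // opprB addrA subrK.
  have {}bc : bnd c `|s| by apply: (bnd_mono sb) bc; apply: ler_norm.
  apply: (bnd_mono sb) (bndB (bndM sb bc (hY k)) (bndM sb (hY k) bc)).
  by rewrite [X in _ + X]mulrC -mulr2n -[leLHS]mulr_natl mulrA.
Qed.

End SquareRoot.

(** * C*-algebras *)

Section CStarBasics.
Variables (R : realType) (A : cstarType R).
Implicit Types a b x y : A.

Lemma scalemAl (k : R[i]) a b : (k *: a) * b = k *: (a * b).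
Proof. exact/esym/cmulZl. Qed.

Lemma scalemAr (k : R[i]) a b : a * (k *: b) = k *: (a * b).
Proof. exact/esym/cmulZr. Qed.

Lemma star_mul a b : star (a * b) = star b * star a.
Proof. exact: starM. Qed.

Lemma rnormM a b : rnorm (a * b) <= rnorm a * rnorm b.
Proof. by rewrite -lecR rmorphM /= -!rnormE; apply: cmul_norm. Qed.

Lemma rnorm_star_mul a : rnorm (star a * a) = rnorm a ^+ 2.
Proof. by apply: complexI; rewrite rmorphXn /= -!rnormE; apply: cstar_norm. Qed.

Lemma rnorm_star a : rnorm (star a) = rnorm a.
Proof.
have h b : rnorm b <= rnorm (star b).
  have := rnorm_ge0 b; rewrite le_eqVlt => /orP[/eqP <-|b0]; first exact: rnorm_ge0.
  by rewrite -(ler_pM2r b0) -expr2 -rnorm_star_mul rnormM.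
by apply/eqP; rewrite eq_le h andbT -{2}(starK a) h.
Qed.

Lemma star_bounds_cstar : star_bounds (@star R A) (fun x t => rnorm x <= t).
Proof.
split.
- exact: starD.
- exact: star_mul.
- exact: starK.
- by move=> x s t st /le_trans ->.
- by rewrite rnorm0.
- by move=> x t; rewrite rnormN.
- by move=> x y s t xs yt; apply: le_trans (rnormD _ _) (lerD xs yt).
- by move=> x y s t xs yt; apply: le_trans (rnormM _ _) (ler_pM (rnorm_ge0 _) (rnorm_ge0 _) xs yt).
- by move=> x t; rewrite rnorm_star.
- by move=> x; apply: rnorm_eps.
move=> y hy.
have [e e0|l hl] := @rnorm_complete R A y.
  have [N hN] := inv_succ_small e0; exists N => m n Nm Nn.
  by case: (leqP m n) => [mn|/ltnW nm]; [rewrite rnorm_distC|];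
     apply: (le_trans (hy _ _ _)) => //; apply/(hN _.+1)/leqW.
exists l => k; apply: ler_eps => e e0; have [N hN] := hl e e0.
have := hN _ (leq_maxl N k); have := hy _ _ (leq_maxr N k).
set m := maxn N k => h1 h2; rewrite -[l](subrK (y m)) -addrA addrC.
by apply: (le_trans (rnormD _ _)); rewrite lerD.
Qed.

Lemma star0 : star 0 = 0 :> A. Proof. exact: (st0 star_bounds_cstar). Qed.
Lemma star1 : star 1 = 1 :> A. Proof. exact: (st1 star_bounds_cstar). Qed.
Lemma starB a b : star (a - b) = star a - star b.
Proof. exact: (stB star_bounds_cstar). Qed.

Lemma star_sum I (r : seq I) (P : pred I) (F : I -> A) :
  star (\sum_(i <- r | P i) F i) = \sum_(i <- r | P i) star (F i).
Proof. by apply: (big_morph _ (@starD R A)); apply: star0. Qed.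

(** [s ^ 2 - star a * a] is positive because [1 - 4 x] has a square root for every
    selfadjoint [x] of norm at most [1 / 4]. *)
Lemma star_mul_le a (s : R) : 0 < s -> rnorm a <= s ->
  exists z, star z * z = 1 - (s ^- 2)%:C *: (star a * a).
Proof.
move=> s0 as_.
pose x := ((s ^- 2) / 4)%:C *: (star a * a).
have c0 : 0 <= (s ^- 2) / 4 by rewrite divr_ge0 // invr_ge0 sqr_ge0.
have [||z [stz zz _]] := sqrt_one_minus star_bounds_cstar (x := x).
- rewrite /x rnormZ normc_real ger0_norm // rnorm_star_mul mul1r.
  rewrite mulrAC ler_piMl ?invr_ge0 // mulrC ler_pdivrMr ?exprn_gt0 // mul1r.
  by rewrite ler_pXn2r ?nnegrE ?rnorm_ge0 // ltW.
- by rewrite /x starZ star_mul starK conj_real.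
exists z; rewrite stz zz /x; congr (1 - _).
by rewrite -scaler_nat scalerA -(rmorph_nat (real_complex R)) -rmorphM mulrC mulfVK.
Qed.

End CStarBasics.

(** * Hilbert spaces and adjoints *)

Section LinearMaps.
Variables (K : pzRingType) (V W : lmodType K).

Lemma linear_pack (f : V -> W) : linear f ->
  exists L : {linear V -> W}, forall x, L x = f x.
Proof.
move=> lf; pose L : {linear V -> W} := HB.pack f (GRing.isLinear.Build K V W _ f lf).
by exists L.
Qed.

Lemma linear_ext (f g : {linear V -> W}) : f =1 g -> f = g.
Proof.
case: f => f [[[f0 fD]] [fZ]]; case: g => g [[[g0 gD]] [gZ]] /= fg.
have E : f = g by apply/funext.
case: _ / E in g0 gD gZ fg *.
by rewrite (Prop_irrelevance f0 g0) (Prop_irrelevance fD gD) (Prop_irrelevance fZ gZ).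
Qed.

End LinearMaps.

Section Hilbert.
Variables (R : realType) (H : completeNormedModType R[i]).
Variable form : {dot H for Num.conj}.
Hypothesis normH : norm_of_inner_product form.
Implicit Types x y z : H.

Lemma formDl x y z : form (x + y) z = form x z + form y z.
Proof. exact: linearDl. Qed.
Lemma formZl a x z : form (a *: x) z = a * form x z.
Proof. exact: linearZl_LR. Qed.
Lemma form_conj x y : (form x y)^* = form y x.
Proof. by rewrite [RHS](hermC form) expr0 mul1r. Qed.
Lemma formDr x y z : form z (x + y) = form z x + form z y.
Proof. by rewrite -form_conj formDl rmorphD /= !form_conj. Qed.
Lemma formZr a x z : form z (a *: x) = a^* * form z x.
Proof. by rewrite -form_conj formZl rmorphM /= !form_conj. Qed.
Lemma formNl x z : form (- x) z = - form x z.
Proof. by rewrite -scaleN1r formZl mulN1r. Qed.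
Lemma formBl x y z : form (x - y) z = form x z - form y z.
Proof. by rewrite formDl formNl. Qed.
Lemma form0l z : form 0 z = 0.
Proof. by rewrite -[0 in LHS](scale0r (0 : H)) formZl mul0r. Qed.
Lemma form0r z : form z 0 = 0.
Proof. by rewrite -form_conj form0l rmorph0. Qed.
Lemma form_suml I (r : seq I) (P : pred I) (F : I -> H) z :
  form (\sum_(i <- r | P i) F i) z = \sum_(i <- r | P i) form (F i) z.
Proof. by apply: (big_morph (form^~ z)) => [x y|]; rewrite ?formDl ?form0l. Qed.
Lemma form_sumr I (r : seq I) (P : pred I) (F : I -> H) z :
  form z (\sum_(i <- r | P i) F i) = \sum_(i <- r | P i) form z (F i).
Proof. by apply: (big_morph (form z)) => [x y|]; rewrite ?formDr ?form0r. Qed.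

Lemma form_diag x : form x x = (rnorm x ^+ 2)%:C.
Proof. by rewrite -normH rnormE rmorphXn. Qed.

Lemma semi_inner_form : semi_inner +%R *:%R form.
Proof.
by split=> [x y z|a x z|x y|x]; rewrite ?formDl ?formZl ?form_conj //.
Qed.

Lemma snorm_form x : snorm form x = rnorm x.
Proof. by rewrite /snorm form_diag /= sqrtr_sqr ger0_norm // rnorm_ge0. Qed.

Lemma form_CS x y : normc (form x y) <= rnorm x * rnorm y.
Proof. by rewrite -!snorm_form; apply: (Cauchy_Schwarz semi_inner_form). Qed.

Lemma form_inj x y : (forall z, form x z = form y z) -> x = y.
Proof.
move=> xy; apply/eqP; rewrite -subr_eq0; apply/eqP/rnorm_eq0/eqP.
rewrite -sqrf_eq0; apply/eqP/complexI; rewrite -form_diag.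
by rewrite formBl xy subrr.
Qed.

(** The approximate representing vectors form a Cauchy sequence: a difference of
    two of them is tested against itself. *)
Theorem Riesz_representation (f : H -> R[i]) (c : R) :
  (forall x y, f (x + y) = f x + f y) -> (forall a x, f (a *: x) = a^* * f x) ->
  (forall x, normc (f x) <= c * rnorm x) -> exists z, forall x, form z x = f x.
Proof.
move=> fD fZ fb.
have inv_gt0 k : 0 < k.+1%:R^-1 :> R by rewrite invr_gt0 ltr0Sn.
have [k|z hz] := choice (P := fun (k : nat) z =>
    forall x, normc (form z x - f x) <= k.+1%:R^-1 * rnorm x).
  have [||||z _ hz] := @approx_riesz _ _ _ _ _ semi_inner_form (fun=> True) f c
    k.+1%:R^-1 _ _ _ fD fZ _ (inv_gt0 k) => //; first by exists 0.
    by move=> x _; rewrite snorm_form.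
  by exists z => x; rewrite -snorm_form hz.
have near x j k : normc (form (z j - z k) x) <= (j.+1%:R^-1 + k.+1%:R^-1) * rnorm x.
  have -> : form (z j - z k) x = (form (z j) x - f x) - (form (z k) x - f x).
    by rewrite formBl; ring.
  by rewrite (le_trans (le_normcD _ _)) // normcN mulrDl lerD.
have [e e0|l hl] := @rnorm_complete R H z.
  have [N hN] := inv_succ_small (divr_gt0 e0 (ltr0Sn _ 1)).
  exists N => j k Nj Nk.
  have := near (z j - z k) j k; rewrite form_diag normc_real ger0_norm ?sqr_ge0 //.
  have := rnorm_ge0 (z j - z k); rewrite le_eqVlt => /orP[/eqP <- _|d0].
    exact: ltW.
  rewrite expr2 ler_pM2r // => /le_trans -> //.
  by rewrite [leRHS]splitr lerD // hN.
exists l => x; apply/eqP; rewrite -subr_eq0; apply/eqP/normc_eq0.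
apply/eqP; rewrite eq_le normc_ge0 andbT; apply: ler_eps => e e0.
have d0 : 0 < e / (2 * (1 + rnorm x)).
  by rewrite divr_gt0 // mulr_gt0 // ltr_pwDl // rnorm_ge0.
have [N hN] := inv_succ_small d0; have [N' hN'] := hl _ d0.
pose k := maxn N N'.
have h1 := hN k (leq_maxl _ _); have h2 := hN' k (leq_maxr _ _).
have -> : form l x - f x = form (l - z k) x + (form (z k) x - f x).
  by rewrite formBl; ring.
rewrite add0r (le_trans (le_normcD _ _)) //.
have h3 := le_trans (form_CS (l - z k) x) (ler_wpM2r (rnorm_ge0 x) h2).
have h4 := le_trans (hz k x) (ler_wpM2r (rnorm_ge0 x) h1).
apply: (le_trans (lerD h3 h4)).
have x0 := rnorm_ge0 x.
have -> : e / (2 * (1 + rnorm x)) * rnorm x + e / (2 * (1 + rnorm x)) * rnorm x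
   = e * (rnorm x / (1 + rnorm x)) by field; rewrite gt_eqF // ltr_pwDl.
by rewrite ler_piMr ?(ltW e0) // ler_pdivrMr ?ltr_pwDl // mul1r lerDr.
Qed.

Lemma adjoint_bounded (T T' : {linear H -> H}) (k : R) : adjoint_of form T T' ->
  0 <= k -> (forall x, rnorm (T x) <= k * rnorm x) ->
  forall x, rnorm (T' x) <= k * rnorm x.
Proof.
move=> TT' k0 Tk x.
have := rnorm_ge0 (T' x); rewrite le_eqVlt => /orP[/eqP <-|n0].
  by rewrite mulr_ge0 ?rnorm_ge0.
rewrite -(ler_pM2r n0) -expr2 -[leLHS]ger0_norm ?sqr_ge0 // -normc_real -form_diag -TT'.
apply: le_trans (form_CS _ _) _.
by rewrite mulrAC ler_wpM2r ?rnorm_ge0.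
Qed.

Lemma adjoint_ex (T : {linear H -> H}) : bounded_map T ->
  exists2 T' : {linear H -> H}, bounded_map T' & adjoint_of form T T'.
Proof.
move=> /bounded_mapP[k k0 Tk].
have [y|T' hT'] := choice (P := fun y z => forall x, form z x = form y (T x)).
  apply: (@Riesz_representation _ (rnorm y * k)).
  - by move=> x z; rewrite linearD formDr.
  - by move=> a x; rewrite linearZ formZr.
  by move=> x; rewrite (le_trans (form_CS _ _)) // -mulrA ler_wpM2l ?rnorm_ge0.
have [a x y|L hL] := @linear_pack _ _ _ T'.
  by apply: form_inj => z; rewrite formDl formZl !hT' formDl formZl.
have adj : adjoint_of form T L.
  by move=> x y; rewrite hL -form_conj -hT' form_conj.
by exists L => //; apply/bounded_mapP; exists k => //; apply: adjoint_bounded adj k0 Tk.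
Qed.

Lemma adjoint_sym (T T' : {linear H -> H}) :
  adjoint_of form T T' -> adjoint_of form T' T.
Proof. by move=> h x y; rewrite -form_conj -h form_conj. Qed.

Lemma commutant_adjoint (S : set {linear H -> H}) T :
  (forall U, S U -> exists2 U', S U' & adjoint_of form U U') ->
  commutant S T -> exists2 T', commutant S T' & adjoint_of form T T'.
Proof.
move=> Sadj [Tb TS]; have [T' T'b adj] := adjoint_ex Tb.
exists T' => //; split=> // U SU x; apply: form_inj => z.
have [U' SU' Uadj] := Sadj U SU.
by rewrite (adjoint_sym adj) Uadj -TS // -(adjoint_sym adj) Uadj.
Qed.

End Hilbert.

(** * Matrices over a represented algebra *)

(** Polarization: the values at [x + y] and at [x + i y] are real. *)
Lemma positive_hermitian (R : realType) (X : Type) (add : X -> X -> X)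
    (scl : R[i] -> X -> X) (B : X -> X -> R[i]) :
  (forall x y z, B (add x y) z = B x z + B y z) ->
  (forall x y z, B z (add x y) = B z x + B z y) ->
  (forall k x z, B (scl k x) z = k * B x z) ->
  (forall k x z, B z (scl k x) = k^* * B z x) ->
  (forall x, 0 <= B x x) -> semi_inner add scl B.
Proof.
move=> Dl Dr Zl Zr ge0; split=> // x y.
have Im0 z : Im (B z z) = 0 by apply: ger0_Im.
have := Im0 (add x y); rewrite Dl !Dr.
have := Im0 (add x (scl 'i y)); rewrite Dl !Dr Zl !Zr Zl -complexiE.
have := Im0 x; have := Im0 y.
case: (B x x) => a1 a2 /=; case: (B y y) => b1 b2 /=.
case: (B x y) => c1 c2; case: (B y x) => d1 d2 /= h1 h2 h3 h4.
by apply/eqP; rewrite eq_complex /=; apply/andP; split; apply/eqP; lra.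
Qed.

Section MatrixAction.
Variables (R : realType) (M : cstarType R) (H : completeNormedModType R[i]).
Variables (form : {dot H for Num.conj}) (rho : M -> {linear H -> H}).
Hypothesis normH : norm_of_inner_product form.
Hypothesis rep : star_representation form rho.
Hypothesis rho_inj : injective rho.
Hypothesis vn : von_neumann_algebra_on form (range rho).

Lemma rep0 h : rho 0 h = 0.
Proof. by rewrite -(scale0r (0 : M)) (star_repZ rep) scale0r. Qed.
Lemma repN x h : rho (- x) h = - rho x h.
Proof. by rewrite -scaleN1r (star_repZ rep) scaleN1r. Qed.
Lemma repB x y h : rho (x - y) h = rho x h - rho y h.
Proof. by rewrite (star_repD rep) repN. Qed.
Lemma rep_sum I (r : seq I) (P : pred I) (F : I -> M) h :
  rho (\sum_(i <- r | P i) F i) h = \sum_(i <- r | P i) rho (F i) h.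
Proof. by apply: (big_morph (rho^~ h)) => [x y|]; rewrite ?(star_repD rep) ?rep0. Qed.

Lemma rep_bounded m : exists2 k : R, 0 <= k & forall h, rnorm (rho m h) <= k * rnorm h.
Proof. by have [b _ _] := vn; apply/bounded_mapP/b; exists m. Qed.

Lemma rep_ext m m' : (forall h, rho m h = rho m' h) -> m = m'.
Proof. by move=> e; apply/rho_inj/linear_ext. Qed.

Lemma bicommutant_mem (T : H -> H) (k : R) : linear T -> 0 <= k ->
  (forall h, rnorm (T h) <= k * rnorm h) ->
  (forall U, commutant (range rho) U -> forall h, T (U h) = U (T h)) ->
  exists m, forall h, rho m h = T h.
Proof.
move=> lT k0 Tk TU; have [L hL] := linear_pack lT.
have : commutant (commutant (range rho)) L.
  split; first by apply/bounded_mapP; exists k => // h; rewrite hL.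
  by move=> U cU h; rewrite !hL TU.
have [_ _ ->] := vn; case=> m _ mL.
by exists m => h; rewrite mL hL.
Qed.

(** A strong limit of operators commutes with everything that the operators
    commute with. *)
Lemma strong_limit (m_ : nat -> M) (k : R) : 0 <= k ->
  (forall n h, rnorm (rho (m_ n) h) <= k * rnorm h) ->
  (forall h (e : R), 0 < e -> exists N, forall i j, (N <= i)%N -> (N <= j)%N ->
     rnorm (rho (m_ i) h - rho (m_ j) h) <= e) ->
  exists m, forall h (e : R), 0 < e -> exists N, forall i, (N <= i)%N ->
     rnorm (rho m h - rho (m_ i) h) <= e.
Proof.
move=> k0 mk cm.
have [h|T hT] := choice (P := fun h l => forall e : R, 0 < e ->
    exists N, forall i, (N <= i)%N -> rnorm (l - rho (m_ i) h) <= e).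
  by have [e e0|l hl] := @rnorm_complete R H (fun i => rho (m_ i) h);
     [exact: cm | exists l].
have Tlim h l (c : R) : 0 <= c -> (forall e : R, 0 < e -> exists N, forall i, (N <= i)%N ->
    rnorm (l - rho (m_ i) h) <= c * e) -> l = T h.
  move=> c0 hl; apply/eqP; rewrite -subr_eq0; apply/eqP/rnorm_eps => e e0.
  have d0 : 0 < e / (1 + c) by rewrite divr_gt0 // ltr_pwDl.
  have [N hN] := hl _ d0; have [N' hN'] := hT h _ d0.
  have -> : l - T h = (l - rho (m_ (maxn N N')) h) - (T h - rho (m_ (maxn N N')) h).
    by rewrite opprB addrA subrK.
  apply: le_trans (rnormB _ _) _.
  apply: le_trans (lerD (hN _ (leq_maxl _ _)) (hN' _ (leq_maxr _ _))) _.
  have -> : c * (e / (1 + c)) + e / (1 + c) = e by field; rewrite gt_eqF // ltr_pwDl.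
  exact: lexx.
have lT : linear T.
  move=> a x y; apply/esym/(@Tlim _ _ (normc a + 1)) => [|e e0].
    by rewrite addr_ge0 ?normc_ge0.
  have [N hN] := hT x _ e0; have [N' hN'] := hT y _ e0.
  exists (maxn N N') => i; rewrite geq_max => /andP[/hN hx /hN' hy].
  rewrite linearP opprD addrACA -scalerBr (le_trans (rnormD _ _)) // rnormZ mulrDl mul1r.
  by rewrite lerD // ler_wpM2l ?normc_ge0.
have Tk h : rnorm (T h) <= k * rnorm h.
  apply: ler_eps => e e0; have [N hN] := hT h _ e0.
  rewrite -[T h](subrK (rho (m_ N) h)) addrC (le_trans (rnormD _ _)) //.
  by rewrite lerD // hN.
have [U cU h|m hm] := bicommutant_mem lT k0 Tk.
  have [Ub comm] := cU; have /bounded_mapP[c c0 Uc] := Ub.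
  apply/esym/(@Tlim _ _ c) => // e e0; have [N hN] := hT h _ e0.
  exists N => i Ni; have <- : U (rho (m_ i) h) = rho (m_ i) (U h) by apply: comm; exists (m_ i).
  by rewrite -linearB (le_trans (Uc _)) // ler_wpM2l // hN.
by exists m => h e e0; rewrite hm; apply: hT.
Qed.

Section Size.
Variable n : nat.
Local Notation Hn := ('I_n -> H).
Implicit Types (xi eta : Hn) (X Y : 'M[M]_n).

Definition tupleD xi eta : Hn := fun i => xi i + eta i.
Definition tupleZ (k : R[i]) xi : Hn := fun i => k *: xi i.
Definition tuple_form xi eta : R[i] := \sum_i form (xi i) (eta i).
Definition mxact X xi : Hn := fun i => \sum_j rho (X i j) (xi j).
Local Notation q := (snorm tuple_form).

Lemma semi_inner_tuple : semi_inner tupleD tupleZ tuple_form.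
Proof.
split=> [x y z|k x z|x y|x]; rewrite /tuple_form.
- by rewrite -big_split; apply: eq_bigr => i _; rewrite formDl.
- by rewrite mulr_sumr; apply: eq_bigr => i _; rewrite formZl.
- by rewrite rmorph_sum; apply: eq_bigr => i _ /=; rewrite form_conj.
- by apply: sumr_ge0 => i _; rewrite (form_diag normH) ler0c sqr_ge0.
Qed.

Lemma tuple_norm_sqr xi : q xi ^+ 2 = \sum_i rnorm (xi i) ^+ 2.
Proof.
rewrite (snorm_sqr semi_inner_tuple) /tuple_form; apply: complexI.
rewrite rmorph_sum /= RRe_real; last by rewrite ger0_real // (si_ge0 semi_inner_tuple).
by apply: eq_bigr => i _; rewrite (form_diag normH).
Qed.

Lemma tuple_norm_le_sum xi : q xi <= \sum_i rnorm (xi i).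
Proof.
have s0 : 0 <= \sum_i rnorm (xi i) by apply: sumr_ge0 => i _; apply: rnorm_ge0.
rewrite -(ler_pXn2r (ltn0Sn 1)) ?nnegrE ?snorm_ge0 // tuple_norm_sqr expr2 mulr_suml.
apply: ler_sum => i _; rewrite expr2 ler_wpM2l ?rnorm_ge0 //.
by rewrite (bigD1 i) //= lerDl sumr_ge0 // => j _; apply: rnorm_ge0.
Qed.

Lemma entry_le_tuple_norm xi i : rnorm (xi i) <= q xi.
Proof.
rewrite -(ler_pXn2r (ltn0Sn 1)) ?nnegrE ?snorm_ge0 ?rnorm_ge0 // tuple_norm_sqr.
by rewrite (bigD1 i) //= lerDl sumr_ge0 // => j _; rewrite sqr_ge0.
Qed.

Lemma tuple_normZ k xi : q (tupleZ k xi) = normc k * q xi.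
Proof.
apply/eqP; rewrite -(eqrXn2 (ltn0Sn 1)) ?mulr_ge0 ?normc_ge0 ?snorm_ge0 //; apply/eqP.
rewrite exprMn !tuple_norm_sqr mulr_sumr; apply: eq_bigr => i _.
by rewrite rnormZ exprMn.
Qed.

Lemma mxactD X Y xi : mxact (X + Y) xi = tupleD (mxact X xi) (mxact Y xi).
Proof.
apply/funext => i; rewrite /mxact /tupleD -big_split; apply: eq_bigr => j _.
by rewrite mxE (star_repD rep).
Qed.

Lemma mxactN X xi : mxact (- X) xi = tupleZ (-1) (mxact X xi).
Proof.
apply/funext => i; rewrite /mxact /tupleZ scaler_sumr; apply: eq_bigr => j _.
by rewrite mxE repN scaleN1r.
Qed.

Lemma mxactM X Y xi : mxact (X * Y) xi = mxact X (mxact Y xi).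
Proof.
apply/funext => i; rewrite /mxact.
under eq_bigr do rewrite mxE rep_sum.
rewrite exchange_big; apply: eq_bigr => j _.
by rewrite linear_sum; apply: eq_bigr => k _; rewrite (star_repM rep).
Qed.

Lemma mxact1 xi : mxact 1 xi = xi.
Proof.
apply/funext => i; rewrite /mxact (bigD1 i) //= big1 => [|j ji].
  by rewrite mxE eqxx (star_rep1 rep) addr0.
by rewrite mxE eq_sym (negPf ji) rep0.
Qed.

Lemma mxactDr X xi eta : mxact X (tupleD xi eta) = tupleD (mxact X xi) (mxact X eta).
Proof.
by apply/funext => i; rewrite /mxact /tupleD -big_split; apply: eq_bigr => j _; rewrite linearD.
Qed.

Lemma mxactZr X k xi : mxact X (tupleZ k xi) = tupleZ k (mxact X xi).
Proof.
by apply/funext => i; rewrite /mxact /tupleZ scaler_sumr; apply: eq_bigr => j _; rewrite linearZ.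
Qed.

Lemma mxact_scale k X xi : mxact (map_mx ( *:%R k) X) xi = tupleZ k (mxact X xi).
Proof.
apply/funext => i; rewrite /mxact /tupleZ scaler_sumr; apply: eq_bigr => j _.
by rewrite mxE (star_repZ rep).
Qed.

Lemma mxact_star X xi eta :
  tuple_form (mxact X xi) eta = tuple_form xi (mxact (mxstar X) eta).
Proof.
rewrite /tuple_form /mxact; under eq_bigr do rewrite form_suml.
rewrite exchange_big; apply: eq_bigr => j _; rewrite form_sumr; apply: eq_bigr => i _.
by rewrite !mxE (star_rep_star rep).
Qed.

Definition opbound X (t : R) : Prop := 0 <= t /\ forall xi, q (mxact X xi) <= t * q xi.

Lemma opbound_ex X : exists t, opbound X t.
Proof.
have [ij|k hk] := choice (P := fun (ij : 'I_n * 'I_n) (k : R) =>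
    0 <= k /\ forall h, rnorm (rho (X ij.1 ij.2) h) <= k * rnorm h).
  by have [k k0 hk] := rep_bounded (X ij.1 ij.2); exists k.
exists (\sum_i \sum_j k (i, j)); split=> [|xi].
  by apply: sumr_ge0 => i _; apply: sumr_ge0 => j _; have [] := hk (i, j).
apply: le_trans (tuple_norm_le_sum _) _; rewrite mulr_suml; apply: ler_sum => i _.
rewrite mulr_suml /mxact; elim/big_ind2: _ => [|x a y b xa yb|j _].
- by rewrite rnorm0.
- exact: le_trans (rnormD _ _) (lerD xa yb).
have [k0 /(_ (xi j))/le_trans -> //] := hk (i, j).
by rewrite ler_wpM2l // entry_le_tuple_norm.
Qed.

Lemma opbound_entry X t i j h : opbound X t -> rnorm (rho (X i j) h) <= t * rnorm h.
Proof.
move=> [t0 Xt]; pose d : Hn := fun k => if k == j then h else 0.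
have qd : q d = rnorm h.
  apply/eqP; rewrite -(eqrXn2 (ltn0Sn 1)) ?snorm_ge0 ?rnorm_ge0 //; apply/eqP.
  rewrite tuple_norm_sqr (bigD1 j) //= big1 ?addr0 => [|k kj]; first by rewrite /d eqxx.
  by rewrite /d (negPf kj) rnorm0 expr0n.
have -> : rho (X i j) h = mxact X d i.
  rewrite /mxact (bigD1 j) //= big1 ?addr0 => [|k kj]; first by rewrite /d eqxx.
  by rewrite /d (negPf kj) linear0.
by apply: le_trans (entry_le_tuple_norm _ _) _; rewrite -qd.
Qed.

End Size.
End MatrixAction.

(** * Positivity of matrices over a von Neumann algebra *)

Section MatrixPositivity.
Variables (R : realType) (M : cstarType R) (H : completeNormedModType R[i]).
Variables (form : {dot H for Num.conj}) (rho : M -> {linear H -> H}).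
Hypothesis normH : norm_of_inner_product form.
Hypothesis rep : star_representation form rho.
Hypothesis rho_inj : injective rho.
Hypothesis vn : von_neumann_algebra_on form (range rho).

Section Size.
Variable n : nat.
Implicit Types (xi eta : 'I_n -> H) (X Y : 'M[M]_n).
Local Notation q := (snorm (@tuple_form _ _ form n)).
Local Notation act := (mxact rho).
Local Notation opb := (@opbound _ _ _ form rho n).
Let siq := semi_inner_tuple normH n.

Lemma mxstarM X Y : mxstar (X * Y) = mxstar Y * mxstar X.
Proof.
apply/matrixP => i j; rewrite !mxE star_sum; apply: eq_bigr => k _.
by rewrite !mxE star_mul.
Qed.

Lemma mxstar_act X xi eta : tuple_form form xi (act X eta) = tuple_form form (act (mxstar X) xi) eta.
Proof. by rewrite (si_herm siq) (mxact_star rep) -(si_herm siq). Qed.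

Lemma opboundD X Y s t : opb X s -> opb Y t -> opb (X + Y) (s + t).
Proof.
move=> [s0 Xs] [t0 Yt]; split=> [|xi]; first exact: addr_ge0.
by rewrite (mxactD rep) (le_trans (snormD siq _ _)) // mulrDl lerD.
Qed.

Lemma opbound_star X t : opb X t -> opb (mxstar X) t.
Proof.
move=> [t0 Xt]; split=> // xi.
have := snorm_ge0 (@tuple_form _ _ form n) (act (mxstar X) xi).
rewrite le_eqVlt => /orP[/eqP <-|p0]; first by rewrite mulr_ge0 ?snorm_ge0.
rewrite -(ler_pM2r p0) -expr2 (snorm_sqr siq) (le_trans (ler_Re_normc _)) //.
rewrite -mxstar_act (le_trans (Cauchy_Schwarz siq _ _)) //.
by rewrite mulrC mulrAC ler_wpM2r ?snorm_ge0.
Qed.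

Lemma opbound_separated X : (forall e : R, 0 < e -> opb X e) -> X = 0.
Proof.
move=> hX; apply/matrixP => i j; rewrite mxE; apply: (rep_ext rho_inj) => h.
rewrite (rep0 rep); apply: rnorm_eps => e e0.
have d0 : 0 < e / (1 + rnorm h) by rewrite divr_gt0 // ltr_pwDl // rnorm_ge0.
apply: le_trans (opbound_entry normH i j h (hX _ d0)) _.
by rewrite mulrAC ler_pdivrMr ?ltr_pwDl ?rnorm_ge0 // ler_pM2l // lerDr.
Qed.

(** The entries have strong limits in [M]; the bounds pass to the limit vector by
    vector. *)
Lemma opbound_complete (y : nat -> 'M[M]_n) :
  (forall k m, (k <= m)%N -> opb (y m - y k) k.+2%:R^-1) ->
  exists l, forall k, opb (l - y k) k.+2%:R^-1.
Proof.
move=> hy.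
have [t0 y0t] := opbound_ex normH vn (y 0%N).
have y_bound k : opb (y k) (2^-1 + t0).
  by rewrite -[y k](subrK (y 0%N)); apply: opboundD => //; apply: hy.
have [[i j]|l hl] := choice (P := fun (ij : 'I_n * 'I_n) m => forall h (e : R), 0 < e ->
   exists N, forall k, (N <= k)%N -> rnorm (rho m h - rho (y k ij.1 ij.2) h) <= e).
  apply: (strong_limit vn (m_ := fun k => y k i j) (k := 2^-1 + t0)) => [|k h|h e e0].
  - by have [] := y_bound 0%N.
  - exact: (opbound_entry normH i j h (y_bound k)).
  have d0 : 0 < e / (1 + rnorm h) by rewrite divr_gt0 // ltr_pwDl // rnorm_ge0.
  have [N hN] := inv_succ_small d0; exists N => a b Na Nb /=.
  have le_ab c d : (N <= c)%N -> (c <= d)%N -> rnorm (rho (y d i j) h - rho (y c i j) h) <= e.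
    move=> Nc cd; have := opbound_entry normH i j h (hy _ _ cd).
    rewrite !mxE (repB rep) => /le_trans -> //.
    apply: le_trans (ler_wpM2r (rnorm_ge0 h) (hN _ (leqW Nc))) _.
    by rewrite mulrAC ler_pdivrMr ?ltr_pwDl ?rnorm_ge0 // ler_pM2l // lerDr.
  by case: (leqP a b) => [ab|/ltnW ba]; [rewrite rnorm_distC|]; apply: le_ab.
exists (\matrix_(i, j) l (i, j)) => k; split=> [|xi]; first by rewrite invr_ge0.
set L := \matrix_(i, j) _.
apply: ler_eps => e e0.
have d0 : 0 < e / (1 + (n * n)%:R) by rewrite divr_gt0 // ltr_pwDl.
have [ij|N hN] := choice (P := fun (ij : 'I_n * 'I_n) N => forall k, (N <= k)%N ->
    rnorm (rho (l ij) (xi ij.2) - rho (y k ij.1 ij.2) (xi ij.2)) <= e / (1 + (n * n)%:R)).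
  exact: hl.
pose m := maxn k (\max_ij N ij).
have -> : L - y k = (L - y m) + (y m - y k) by rewrite addrA subrK.
rewrite (mxactD rep) (le_trans (snormD siq _ _)) // addrC lerD //.
  by have [_] := hy k m (leq_maxl _ _); apply.
apply: le_trans (tuple_norm_le_sum normH _) _.
have -> : e = \sum_(i < n) (e / (1 + (n * n)%:R)) *+ n + e / (1 + (n * n)%:R).
  rewrite sumr_const card_ord -mulrnA -[_ *+ (n * n)]mulr_natl.
  by field; rewrite gt_eqF // ltr_pwDl.
rewrite ler_wpDr ?(ltW d0) //; apply: ler_sum => i _.
move: (e / _) hN => d hN.
rewrite -[n in leRHS]card_ord -sumr_const /mxact.
elim/big_ind2: _ => [|x a z b xa zb|j _].
- by rewrite rnorm0.
- exact: le_trans (rnormD _ _) (lerD xa zb).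
rewrite /L !mxE (repB rep); apply: (hN (i, j)).
by rewrite /m leq_max (leq_bigmax (i, j)) orbT.
Qed.

Lemma star_bounds_matrix : star_bounds (@mxstar R M n) opb.
Proof.
split.
- by move=> X Y; apply/matrixP => i j; rewrite !mxE starD.
- exact: mxstarM.
- by move=> X; apply/matrixP => i j; rewrite !mxE starK.
- move=> X s t st [s0 Xs]; split=> [|xi]; first exact: le_trans st.
  by apply: le_trans (Xs xi) _; rewrite ler_wpM2r ?snorm_ge0.
- split=> // xi; rewrite mul0r (le_trans (tuple_norm_le_sum normH _)) //.
  rewrite big1 // => i _; rewrite /mxact big1 ?rnorm0 // => j _.
  by rewrite mxE (rep0 rep).
- by move=> X t [t0 Xt]; split=> // xi; rewrite (mxactN rep) (tuple_normZ normH) normcN normc1 mul1r.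
- exact: opboundD.
- move=> X Y s t [s0 Xs] [t0 Yt]; split=> [|xi]; first exact: mulr_ge0.
  by rewrite (mxactM rep) (le_trans (Xs _)) // -mulrA ler_wpM2l.
- exact: opbound_star.
- exact: opbound_separated.
- exact: opbound_complete.
Qed.

(** Positive operators in a von Neumann algebra have square roots there: after
    rescaling, [0 <= T <= 1] makes [1 - T] a contraction, by the Cauchy-Schwarz
    inequality for the form of [T]. *)
Theorem mxpositive_of_form (T : 'M[M]_n) :
  (forall xi, 0 <= tuple_form form (act T xi) xi) -> mxpositive T.
Proof.
move=> T0.
have siT : semi_inner (@tupleD _ H n) (@tupleZ _ H n) (fun xi eta => tuple_form form (act T xi) eta).
  apply: positive_hermitian => // [x y z|x y z|k x z|k x z].
  - by rewrite mxactDr (si_Dl siq).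
  - by rewrite (si_Dr siq).
  - by rewrite mxactZr (si_Zl siq).
  - by rewrite (si_Zr siq).
have stT : mxstar T = T.
  apply/eqP; rewrite -subr_eq0; apply/eqP/opbound_separated => e e0; split=> [|xi].
    exact: ltW.
  rewrite (snorm_le siq) ?mulr_ge0 ?snorm_ge0 ?(ltW e0) //.
  have -> : tuple_form form (act (mxstar T - T) xi) (act (mxstar T - T) xi) = 0.
    set eta := {2}(act _ xi).
    rewrite (mxactD rep) (mxactN rep) (si_Dl siq) (si_Zl siq) mulN1r -mxstar_act.
    by rewrite (si_herm siq) -(si_herm siT) subrr.
  by rewrite sqr_ge0.
have [c0 Tc0] := opbound_ex normH vn T.
pose c := c0 + 1.
have c_gt0 : 0 < c by rewrite /c ltr_wpDl //; case: Tc0.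
have Tc xi : q (act T xi) <= c * q xi.
  have [_ /(_ xi)/le_trans -> //] := Tc0.
  by rewrite ler_wpM2r ?snorm_ge0 // lerDl.
have c_neq0 : c != 0 by rewrite gt_eqF.
pose T1 := map_mx ( *:%R (c^-1)%:C) T.
have T1act xi : act T1 xi = tupleZ (c^-1)%:C (act T xi) by rewrite (mxact_scale rep).
(* [|T1 xi| ^ 2 <= (T1 xi, xi)] since [0 <= T1 <= 1] *)
have T1sqr xi : q (act T1 xi) ^+ 2 <= Re (tuple_form form (act T1 xi) xi).
  rewrite T1act (tuple_normZ normH) (si_Zl siq) Re_real_mul normc_real.
  rewrite ger0_norm ?invr_ge0 ?(ltW c_gt0) //.
  rewrite -(snorm_sqr siT); set g := snorm _ xi.
  rewrite exprMn expr2 -mulrA ler_pM2l ?invr_gt0 //.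
  rewrite ler_pdivrMl //.
  set eta := act T xi.
  have h1 : q eta ^+ 2 <= g * snorm (fun x y => tuple_form form (act T x) y) eta.
    by rewrite (snorm_sqr siq) (le_trans (ler_Re_normc _)) // (Cauchy_Schwarz siT xi eta).
  have h2 : snorm (fun x y => tuple_form form (act T x) y) eta ^+ 2 <= c * q eta ^+ 2.
    rewrite (snorm_sqr siT) (le_trans (ler_Re_normc _)) // (le_trans (Cauchy_Schwarz siq _ _)) //.
    by rewrite expr2 mulrA ler_wpM2r ?snorm_ge0.
  have g0 : 0 <= g by apply: snorm_ge0.
  have a0 := snorm_ge0 (fun x y => tuple_form form (act T x) y) eta.
  have := snorm_ge0 (@tuple_form _ _ form n) eta.
  move: (q eta) (snorm (fun x y => tuple_form form (act T x) y) eta) h1 h2 a0.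
  move=> b a h1 h2 a0; rewrite le_eqVlt => /orP[/eqP <-|b0].
    by rewrite expr0n mulr_ge0 ?sqr_ge0 // ltW.
  have h3 : (b ^+ 2) ^+ 2 <= c * g ^+ 2 * b ^+ 2.
    have -> : c * g ^+ 2 * b ^+ 2 = g ^+ 2 * (c * b ^+ 2) by ring.
    apply: le_trans (ler_wpM2l (sqr_ge0 g) h2).
    by rewrite -exprMn ler_pXn2r // nnegrE ?sqr_ge0 // mulr_ge0.
  by move: h3; rewrite [in leLHS]expr2 ler_pM2r ?exprn_gt0.
pose x := map_mx ( *:%R (1 / 4)%:C) (1 - T1).
have x4 : x *+ 4 = 1 - T1.
  apply/matrixP => i j; rewrite mulmxnE !mxE -scaler_nat scalerA.
  rewrite -(rmorph_nat (real_complex R)) -rmorphM mulrC mulfVK ?scale1r //.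
have stx : mxstar x = x.
  apply/matrixP => i j; rewrite !mxE starZ starB starZ.
  have -> : star (T j i) = T i j by rewrite -{2}stT !mxE.
  have -> : star ((j == i)%:R : M) = (i == j)%:R.
    by rewrite eq_sym; case: (i == j); rewrite ?star1 ?star0.
  by rewrite !conj_real.
have bx : opb x (1 / 4).
  split=> [|xi]; first by rewrite divr_ge0.
  rewrite (mxact_scale rep) (tuple_normZ normH) normc_real ger0_norm ?divr_ge0 //.
  rewrite ler_wpM2l ?divr_ge0 // (snorm_le siq) ?snorm_ge0 //.
  rewrite (mxactD rep) (mxactN rep) (mxact1 rep).
  have -> : (-1 : R[i]) = - (1%:C * 1) by rewrite mulr1.
  rewrite (si_expand siq) rmorph1 mul1r normc1 !expr1n !mul1r mulr1.
  have := T1sqr xi; rewrite (si_herm siq).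
  have -> z : Re (z^*)%R = Re z :> R by case: z.
  have := sqr_ge0 (q (act T1 xi)); lra.
have [z [stz zz _]] := sqrt_one_minus star_bounds_matrix bx stx.
exists (map_mx ( *:%R (Num.sqrt c)%:C) z).
apply/matrixP => i j.
have -> : T i j = c%:C *: T1 i j.
  by rewrite mxE scalerA -rmorphM mulfV // scale1r.
have -> : T1 = mxstar z * z by rewrite stz zz x4 opprB addrC subrK.
rewrite !mxE scaler_sumr; apply: eq_bigr => k _; rewrite !mxE starZ.
rewrite scalemAl scalemAr scalerA.
by rewrite conj_real -rmorphM -expr2 sqr_sqrtr // ltW.
Qed.

End Size.
End MatrixPositivity.

(** * Comparison of the abstract norm with the operator norm *)

Section OperatorNorm.
Variables (R : realType) (M : cstarType R) (H : completeNormedModType R[i]).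
Variables (form : {dot H for Num.conj}) (rho : M -> {linear H -> H}).
Hypothesis normH : norm_of_inner_product form.
Hypothesis rep : star_representation form rho.
Hypothesis rho_inj : injective rho.
Hypothesis vn : von_neumann_algebra_on form (range rho).

Lemma opbound_const a (t : R) : 0 <= t -> (forall h, rnorm (rho a h) <= t * rnorm h) ->
  opbound form rho (const_mx a : 'M[M]_1) t.
Proof.
move=> t0 at_; split=> // xi.
rewrite -(ler_pXn2r (ltn0Sn 1)) ?nnegrE ?mulr_ge0 ?snorm_ge0 //.
rewrite exprMn !(tuple_norm_sqr normH) !big_ord1 /mxact big_ord1 mxE -exprMn.
by rewrite ler_pXn2r ?nnegrE ?mulr_ge0 ?rnorm_ge0.
Qed.

Lemma rnorm1_le : rnorm (1 : M) <= 1.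
Proof.
have : rnorm (1 : M) = rnorm (1 : M) * rnorm (1 : M).
  by rewrite -expr2 -rnorm_star_mul star1 mulr1.
have := rnorm_ge0 (1 : M); move: (rnorm (1 : M)) => x x0 xx; nra.
Qed.

(** A selfadjoint [m] that acts as a contraction is the real part of the unitary
    [m + i (1 - m ^ 2) ^ (1 / 2)], whose norm is at most [1] by the C*-identity. *)
Lemma rnorm_selfadjoint_contraction m : star m = m ->
  (forall h, rnorm (rho m h) <= rnorm h) -> rnorm m <= 1.
Proof.
move=> stm mc.
pose X : 'M[M]_1 := const_mx m.
have bX : opbound form rho X 1 by apply: opbound_const => // h; rewrite mul1r.
pose x : 'M[M]_1 := const_mx ((1 / 4)%:C *: (m * m)).
have bx : opbound form rho x (1 / 4).
  apply: opbound_const => [|h]; first by rewrite divr_ge0.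
  rewrite (star_repZ rep) rnormZ normc_real ger0_norm ?divr_ge0 //.
  by rewrite ler_wpM2l ?divr_ge0 // (star_repM rep) (le_trans (mc _)).
have stx : mxstar x = x.
  by apply/matrixP => i j; rewrite !mxE starZ star_mul stm conj_real.
have [z [stz zz zC]] :=
  sqrt_one_minus (star_bounds_matrix normH rep rho_inj vn 1) bx stx.
pose c := z 0 0.
have stc : star c = c by rewrite {2}/c -stz !mxE.
have cc : c * c = 1 - m * m.
  have := congr1 (fun Y : 'M[M]_1 => Y 0 0) zz.
  rewrite /= mxE big_ord1 -/c => ->.
  have -> : (1 - x *+ 4) 0 0 = 1 - x 0 0 *+ 4 by rewrite -mulmxnE !mxE.
  rewrite !mxE -scaler_nat scalerA.
  by rewrite -(rmorph_nat (real_complex R)) -rmorphM mulrC mulfVK ?scale1r.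
have mcC : m * c = c * m.
  have Xx : X * x = x * X.
    by apply/matrixP => i j; rewrite !mxE !big_ord1 !mxE scalemAl scalemAr mulrA.
  have := congr1 (fun Y : 'M[M]_1 => Y 0 0) (zC _ _ bX Xx).
  by rewrite !mxE !big_ord1 !mxE.
pose u := m + 'i *: c.
have stu : star u = m - 'i *: c by rewrite /u starD starZ stm stc conjCi scaleNr.
have uu : star u * u = 1.
  rewrite stu /u mulrDr !mulrBl !scalemAl !scalemAr mcC scalerA -['i * 'i]expr2 sqrCi scaleN1r opprK.
  by rewrite addrA subrK cc addrC subrK.
have u1 : rnorm u <= 1.
  rewrite -(ler_pXn2r (ltn0Sn 1)) ?nnegrE ?rnorm_ge0 // -rnorm_star_mul uu expr1n.
  exact: rnorm1_le.
have -> : m = (1 / 2)%:C *: (u + star u).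
  rewrite stu /u addrACA subrr addr0 -mulr2n -[m *+ 2]scaler_nat scalerA.
  by rewrite -(rmorph_nat (real_complex R)) -rmorphM mulfVK ?scale1r.
rewrite rnormZ normc_real ger0_norm ?divr_ge0 //.
have := rnormD u (star u); rewrite rnorm_star; lra.
Qed.

Lemma rnorm_selfadjoint_le m (c : R) : star m = m -> 0 <= c ->
  (forall h, rnorm (rho m h) <= c * rnorm h) -> rnorm m <= c.
Proof.
move=> stm c0 mc; apply: ler_eps => e e0.
have d0 : 0 < c + e by rewrite ltr_wpDl.
have h : rnorm ((c + e)^-1%:C *: m) <= 1.
  apply: rnorm_selfadjoint_contraction => [|h]; first by rewrite starZ stm conj_real.
  rewrite (star_repZ rep) rnormZ normc_real ger0_norm ?invr_ge0 ?(ltW d0) //.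
  rewrite ler_pdivrMl // (le_trans (mc h)) // ler_wpM2r ?rnorm_ge0 // lerDl.
  exact: ltW.
move: h; rewrite rnormZ normc_real ger0_norm ?invr_ge0 ?(ltW d0) //.
by rewrite ler_pdivrMl // mulr1.
Qed.

(** The faithful representation controls the abstract norm: split [m] into its
    real and imaginary parts. *)
Lemma rnorm_le_operator m (c : R) : 0 <= c ->
  (forall h, rnorm (rho m h) <= c * rnorm h) -> rnorm m <= 2 * c.
Proof.
move=> c0 mc.
have mc' h : rnorm (rho (star m) h) <= c * rnorm h.
  exact: (adjoint_bounded normH (star_rep_star rep m) c0 mc).
pose a := (1 / 2)%:C *: (m + star m).
pose b := (1 / 2)%:C *: ('i *: (star m - m)).
have half_ge0 : 0 <= 1 / 2 :> R by rewrite divr_ge0.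
have normi : normc 'i = 1 :> R.
  by apply: complexI; rewrite -normrE_normc normCi.
have ac : rnorm a <= c.
  apply: rnorm_selfadjoint_le => // [|h].
    by rewrite /a starZ conj_real starD starK addrC.
  rewrite (star_repZ rep) rnormZ normc_real ger0_norm // (star_repD rep).
  have := rnormD (rho m h) (rho (star m) h); have := mc h; have := mc' h; lra.
have bc : rnorm b <= c.
  apply: rnorm_selfadjoint_le => // [|h].
    by rewrite /b starZ conj_real starZ conjCi starB starK scaleNr -scalerN opprB.
  rewrite !(star_repZ rep) !rnormZ normi normc_real ger0_norm // mul1r (repB rep).
  have := rnormB (rho (star m) h) (rho m h); have := mc h; have := mc' h; lra.
have -> : m = a + 'i *: b.
  rewrite /a /b !scalerA mulrAC -expr2 sqrCi mulN1r scaleNr -scalerN opprB -scalerDr.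
  rewrite addrACA subrr addr0 -mulr2n -[m *+ 2]scaler_nat scalerA.
  by rewrite -(rmorph_nat (real_complex R)) -rmorphM mulfVK ?scale1r.
by rewrite (le_trans (rnormD _ _)) // [rnorm ('i *: _)]rnormZ normi mul1r mulr_natl mulr2n lerD.
Qed.

End OperatorNorm.

(** * Completely positive maps as forms on tensors *)

Section FormalTensors.
Variables (R : realType) (A M : cstarType R) (H : completeNormedModType R[i]).
Variables (form : {dot H for Num.conj}) (rho : M -> {linear H -> H}).
Hypothesis normH : norm_of_inner_product form.
Hypothesis rep : star_representation form rho.
Hypothesis rho_inj : injective rho.
Hypothesis vn : von_neumann_algebra_on form (range rho).

(** The list [:: (a1, h1); ...] stands for the tensor [a1 (x) h1 + ...]; addition
    is concatenation. *)
Local Notation X := (seq (A * H)).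
Implicit Types (xi eta zeta : X) (v w : {linear A -> M}).

Definition tensor_scale (k : R[i]) xi : X := [seq (x.1, k *: x.2) | x <- xi].
Definition tensor_act (b : A) xi : X := [seq (b * x.1, x.2) | x <- xi].
Definition tensor_map (T : H -> H) xi : X := [seq (x.1, T x.2) | x <- xi].

(** For completely positive [v] this is the semi-inner product of Stinespring's
    construction. *)
Definition map_form (v : A -> M) xi eta : R[i] :=
  \sum_(x <- xi) \sum_(y <- eta) form (rho (v (star y.1 * x.1)) x.2) y.2.

Lemma map_form1 (v : A -> M) a h b k :
  map_form v [:: (a, h)] [:: (b, k)] = form (rho (v (star b * a)) h) k.
Proof. by rewrite /map_form !big_seq1. Qed.

Lemma map_form_vector (v : A -> M) a h k :
  form (rho (v a) h) k = map_form v [:: (a, h)] [:: (1, k)].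
Proof. by rewrite map_form1 star1 mul1r. Qed.

Lemma map_form_catl (v : A -> M) xi eta zeta :
  map_form v (xi ++ eta) zeta = map_form v xi zeta + map_form v eta zeta.
Proof. by rewrite /map_form big_cat. Qed.

Lemma map_form_catr (v : A -> M) xi eta zeta :
  map_form v zeta (xi ++ eta) = map_form v zeta xi + map_form v zeta eta.
Proof. by rewrite /map_form -big_split; apply: eq_bigr => x _; rewrite big_cat. Qed.

Lemma map_form_scalel (v : A -> M) k xi zeta :
  map_form v (tensor_scale k xi) zeta = k * map_form v xi zeta.
Proof.
rewrite /map_form big_map mulr_sumr; apply: eq_bigr => x _.
by rewrite mulr_sumr; apply: eq_bigr => y _; rewrite linearZ formZl.
Qed.

Lemma map_form_scaler (v : A -> M) k xi zeta :
  map_form v zeta (tensor_scale k xi) = k^* * map_form v zeta xi.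
Proof.
rewrite /map_form mulr_sumr; apply: eq_bigr => x _.
by rewrite big_map mulr_sumr; apply: eq_bigr => y _; rewrite formZr.
Qed.

Lemma map_form_act (v : A -> M) b xi eta :
  map_form v (tensor_act b xi) eta = map_form v xi (tensor_act (star b) eta).
Proof.
rewrite /map_form big_map; apply: eq_bigr => x _; rewrite big_map.
by apply: eq_bigr => y _ /=; rewrite star_mul starK mulrA.
Qed.

Lemma map_form_add (u v w : A -> M) xi eta : (forall a, u a = v a + w a) ->
  map_form u xi eta = map_form v xi eta + map_form w xi eta.
Proof.
move=> uvw; rewrite /map_form -big_split; apply: eq_bigr => x _.
by rewrite -big_split; apply: eq_bigr => y _ /=; rewrite uvw (star_repD rep) formDl.
Qed.

Lemma map_form_scale_map (u v : A -> M) k xi eta : (forall a, u a = k *: v a) ->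
  map_form u xi eta = k * map_form v xi eta.
Proof.
move=> uv; rewrite /map_form mulr_sumr; apply: eq_bigr => x _.
by rewrite mulr_sumr; apply: eq_bigr => y _ /=; rewrite uv (star_repZ rep) formZl.
Qed.

Lemma map_form_actD v a b xi eta : map_form v (tensor_act (a + b) xi) eta =
  map_form v (tensor_act a xi) eta + map_form v (tensor_act b xi) eta.
Proof.
rewrite /map_form !big_map -big_split; apply: eq_bigr => x _.
rewrite -big_split; apply: eq_bigr => y _ /=.
by rewrite mulrDl mulrDr linearD (star_repD rep) formDl.
Qed.

Lemma map_form_actZ v k a xi eta : map_form v (tensor_act (k *: a) xi) eta =
  k * map_form v (tensor_act a xi) eta.
Proof.
rewrite /map_form !big_map mulr_sumr; apply: eq_bigr => x _.
rewrite mulr_sumr; apply: eq_bigr => y _ /=.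
by rewrite scalemAl scalemAr linearZ (star_repZ rep) formZl.
Qed.

Lemma tensor_act1 xi : tensor_act 1 xi = xi.
Proof. by rewrite -[RHS]map_id; apply: eq_map => -[a h]; rewrite mul1r. Qed.

Lemma tensor_actA a b xi : tensor_act a (tensor_act b xi) = tensor_act (a * b) xi.
Proof. by rewrite /tensor_act -map_comp; apply: eq_map => x /=; rewrite mulrA. Qed.

Lemma map_form_commutant (v : A -> M) (T T' : {linear H -> H}) xi eta :
  commutant (range rho) T -> adjoint_of form T T' ->
  map_form v (tensor_map T xi) eta = map_form v xi (tensor_map T' eta).
Proof.
move=> [_ cT] adj; rewrite /map_form big_map; apply: eq_bigr => x _; rewrite big_map.
by apply: eq_bigr => y _ /=; rewrite -cT ?adj //; eexists.
Qed.

Definition positive_form (v : A -> M) : Prop := forall xi, 0 <= map_form v xi xi.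

Lemma positive_form_semi_inner (v : A -> M) : positive_form v ->
  semi_inner cat tensor_scale (map_form v).
Proof.
move=> v0; apply: positive_hermitian => //.
- exact: map_form_catl.
- by move=> *; apply: map_form_catr.
- exact: map_form_scalel.
- by move=> *; apply: map_form_scaler.
Qed.

(** Complete positivity turns the form into a sum of squares, simultaneously for
    all operators [T] on the second tensor factor. *)
Lemma map_form_squares v xi : completely_positive v ->
  exists Z : 'M[M]_(size xi), forall T : H -> H,
    let TZ := mxact rho Z (fun i => T (tnth (in_tuple xi) i).2) in
    map_form v (tensor_map T xi) (tensor_map T xi) = tuple_form form TZ TZ.
Proof.
move=> cpv; pose n := size xi; pose x i := tnth (in_tuple xi) i.
(* the row of the [a_i], completed by zeros to a square matrix *)
pose Y : 'M[A]_n := \matrix_(k, i) (if val k == 0%N then (x i).1 else 0).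
have YE j i : (mxstar Y *m Y) j i = star (x j).1 * (x i).1.
  rewrite mxE; have n0 : (0 < n)%N by apply: leq_trans (ltn_ord i).
  rewrite (bigD1 (Ordinal n0)) //= big1 ?addr0 => [|k k0]; first by rewrite !mxE.
  rewrite !mxE; case: ifP => [/eqP k_eq0|_]; last by rewrite mulr0.
  by case/eqP: k0; apply: val_inj.
have [Z ZE] := cpv n _ (ex_intro _ Y erefl).
exists Z => T /=; pose h i := T (x i).2.
transitivity (tuple_form form (mxact rho (mxstar Z * Z) h) h); last first.
  rewrite (mxactM rep) (mxact_star rep).
  by have -> : mxstar (mxstar Z) = Z by apply/matrixP => i j; rewrite !mxE starK.
rewrite /map_form big_map big_tnth /tuple_form /mxact.
under [RHS]eq_bigr do rewrite form_suml.
rewrite [RHS]exchange_big; apply: eq_bigr => i _; rewrite big_map [LHS]big_tnth.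
apply: eq_bigr => j _ /=.
by have := congr1 (fun T : 'M[M]_n => T j i) ZE; rewrite mxE YE => ->.
Qed.

Lemma completely_positive_form v : completely_positive v -> positive_form v.
Proof.
move=> cpv xi; have [Z ZE] := map_form_squares xi cpv.
have -> : xi = tensor_map id xi by rewrite -[LHS]map_id; apply: eq_map => -[].
by rewrite ZE (si_ge0 (semi_inner_tuple normH _)).
Qed.

(** The value at [star Y * Y] is a sum over the rows of [Y] of values of the form,
    so that positivity in [M_n(M)] follows from [mxpositive_of_form]. *)
Lemma positive_form_completely_positive v : positive_form v -> completely_positive v.
Proof.
move=> v0 n _ [Y ->]; apply: (mxpositive_of_form normH rep rho_inj vn) => xi.
have -> : tuple_form form (mxact rho (map_mx v (mxstar Y *m Y)) xi) xi =
    \sum_k map_form v [seq (Y k i, xi i) | i <- enum 'I_n] [seq (Y k i, xi i) | i <- enum 'I_n].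
  rewrite /tuple_form /mxact.
  transitivity (\sum_i \sum_j \sum_k form (rho (v (star (Y k i) * Y k j)) (xi j)) (xi i)).
    apply: eq_bigr => i _; rewrite form_suml; apply: eq_bigr => j _.
    rewrite !mxE linear_sum (rep_sum rep) form_suml.
    by apply: eq_bigr => k _; rewrite !mxE.
  under eq_bigr do rewrite exchange_big.
  rewrite exchange_big; apply: eq_bigr => k _.
  rewrite exchange_big /map_form big_map big_enum; apply: eq_bigr => j _ /=.
  by rewrite big_map big_enum.
by apply: sumr_ge0.
Qed.

(** The matrix [Z] of the sum of squares has entries in [M], so that it commutes
    with [T] acting on each entry of a vector. *)
Lemma tensor_map_bounded v (T : {linear H -> H}) (c : R) xi : positive_form v ->
  commutant (range rho) T -> 0 <= c -> (forall h, rnorm (T h) <= c * rnorm h) ->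
  snorm (map_form v) (tensor_map T xi) <= c * snorm (map_form v) xi.
Proof.
move=> v0 [_ cT] c0 Tc; have si := positive_form_semi_inner v0.
have [Z ZE] := map_form_squares xi (positive_form_completely_positive v0).
rewrite (snorm_le si) ?mulr_ge0 ?snorm_ge0 // exprMn (snorm_sqr si xi).
have := ZE id; have -> : tensor_map id xi = xi.
  by rewrite -[RHS]map_id; apply: eq_map => -[].
move=> ->; rewrite ZE -!(snorm_sqr (semi_inner_tuple normH _)) !(tuple_norm_sqr normH).
rewrite mulr_sumr; apply: ler_sum => i _; rewrite -exprMn.
rewrite ler_pXn2r ?nnegrE ?mulr_ge0 ?rnorm_ge0 //.
set S := mxact _ _ _ i; have -> : S = T (mxact rho Z (fun i => (tnth (in_tuple xi) i).2) i).
  rewrite /S /mxact linear_sum; apply: eq_bigr => j _.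
  by rewrite cT //; eexists.
exact: Tc.
Qed.

(** The symmetry of the form at the pair [a (x) h], [1 (x) k]. *)
Lemma positive_form_star v a : positive_form v -> v (star a) = star (v a).
Proof.
move=> v0; apply: (rep_ext rho_inj) => h; apply: (form_inj normH) => k.
rewrite map_form_vector (si_herm (positive_form_semi_inner v0)) map_form1 mulr1 starK.
by rewrite form_conj (star_rep_star rep) starK.
Qed.

Lemma map_form_act_sqr (v : A -> M) b xi :
  map_form v (tensor_act b xi) (tensor_act b xi) = map_form v (tensor_act (star b * b) xi) xi.
Proof. by rewrite -tensor_actA [RHS]map_form_act starK. Qed.

(** With [star z * z = 1 - star a * a / s ^ 2], the square of the seminorm of
    [z xi], times [s ^ 2], is the difference of the squares of the two sides. *)
Lemma tensor_act_bounded v a (s : R) xi : positive_form v -> 0 < s -> rnorm a <= s ->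
  snorm (map_form v) (tensor_act a xi) <= s * snorm (map_form v) xi.
Proof.
move=> v0 s0 as_; have si := positive_form_semi_inner v0.
rewrite (snorm_le si) ?mulr_ge0 ?(ltW s0) ?snorm_ge0 //.
have [z zz] := star_mul_le s0 as_.
have := v0 (tensor_act z xi); rewrite map_form_act_sqr zz -scaleNr.
rewrite map_form_actD map_form_actZ tensor_act1 -map_form_act_sqr complex_ge0 => /andP[_].
rewrite -rmorphN raddfD /= Re_real_mul -(snorm_sqr si xi) mulNr subr_ge0.
by rewrite mulrC ler_pdivrMr ?exprn_gt0 // exprMn mulrC.
Qed.

Lemma unit_tensor_bounded v : positive_form v ->
  exists2 K : R, 0 <= K & forall h, snorm (map_form v) [:: (1, h)] <= K * rnorm h.
Proof.
move=> v0; have si := positive_form_semi_inner v0.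
have [k k0 hk] := rep_bounded vn (v 1).
exists (Num.sqrt k) => [|h]; first exact: sqrtr_ge0.
rewrite (snorm_le si) ?mulr_ge0 ?sqrtr_ge0 ?rnorm_ge0 // exprMn sqr_sqrtr //.
rewrite map_form1 star1 mulr1 (le_trans (ler_Re_normc _)) //.
rewrite (le_trans (form_CS normH _ _)) // [_ ^+ 2]expr2 mulrA.
by rewrite ler_wpM2r ?rnorm_ge0.
Qed.

(** Cauchy-Schwarz for the form bounds the operator [rho (v a)]; the norm of [M] is
    then recovered from [rnorm_le_operator]. *)
Lemma positive_form_bounded v : positive_form v -> bounded_map v.
Proof.
move=> v0; have si := positive_form_semi_inner v0.
have [K K0 hK] := unit_tensor_bounded v0.
apply/bounded_mapP; exists (2 * K ^+ 2) => [|a]; first by rewrite mulr_ge0 ?sqr_ge0.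
have := rnorm_ge0 a; rewrite le_eqVlt => /orP[/eqP a0|a0].
  by rewrite -a0 (rnorm_eq0 (esym a0)) linear0 rnorm0 mulr0.
rewrite -mulrA; apply: (rnorm_le_operator normH rep rho_inj vn) => [|h].
  by rewrite mulr_ge0 ?sqr_ge0 // ltW.
set g := rho (v a) h.
have h1 : rnorm g ^+ 2 <= snorm (map_form v) [:: (a, h)] * snorm (map_form v) [:: (1, g)].
  rewrite -[leLHS]ger0_norm ?sqr_ge0 // -normc_real -(form_diag normH) {1}/g.
  by rewrite map_form_vector (Cauchy_Schwarz si).
have h2 : snorm (map_form v) [:: (a, h)] <= rnorm a * (K * rnorm h).
  have := tensor_act_bounded [:: (1, h)] v0 a0 (lexx _); rewrite /tensor_act /= mulr1.
  by move=> /le_trans -> //; rewrite ler_pM2l.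
have := rnorm_ge0 g; rewrite le_eqVlt => /orP[/eqP <-|g0].
  by rewrite !mulr_ge0 ?rnorm_ge0.
rewrite -(ler_pM2r g0) -expr2; apply: le_trans h1 _.
have -> : K ^+ 2 * rnorm a * rnorm h * rnorm g = rnorm a * (K * rnorm h) * (K * rnorm g).
  by ring.
by rewrite ler_pM ?snorm_ge0.
Qed.

End FormalTensors.

(** * Balanced domination *)

Section BimoduleDomination.
Variables (R : realType) (A M : cstarType R) (C : set A) (pi : A -> M).
Variables (H : completeNormedModType R[i]) (form : {dot H for Num.conj}).
Variable rho : M -> {linear H -> H}.
Hypothesis normH : norm_of_inner_product form.
Hypothesis rep : star_representation form rho.
Hypothesis rho_inj : injective rho.
Hypothesis vn : von_neumann_algebra_on form (range rho).
Local Notation X := (seq (A * H)).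
Local Notation mform := (map_form form rho).
Local Notation scale := (@tensor_scale R A H).
Local Notation act := (@tensor_act R A H).

(** The span of the tensors [a c (x) h - a (x) pi(c) h], on which the form of a
    right [C]-module map vanishes. *)
Inductive balancing : X -> Prop :=
| balancing_nil : balancing [::]
| balancing_cons a c h n : C c -> balancing n ->
    balancing [:: (a * c, h), (a, - rho (pi c) h) & n].

Lemma balancing_cat m n : balancing m -> balancing n -> balancing (m ++ n).
Proof. by elim=> // a c h m' Cc _ IH bn; apply: balancing_cons => //; apply: IH. Qed.

Lemma balancing_scale k n : balancing n -> balancing (scale k n).
Proof.
elim=> [|a c h n' Cc _ IH]; first exact: balancing_nil.
by rewrite /= scalerN -linearZ; apply: balancing_cons.
Qed.

Lemma balancing_act b n : balancing n -> balancing (act b n).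
Proof.
elim=> [|a c h n' Cc _ IH]; first exact: balancing_nil.
by rewrite /= mulrA; apply: balancing_cons.
Qed.

Lemma balancing_map (T : {linear H -> H}) n : commutant (range rho) T ->
  balancing n -> balancing (tensor_map T n).
Proof.
move=> [_ cT]; elim=> [|a c h n' Cc _ IH]; first exact: balancing_nil.
by rewrite /= linearN cT; [apply: balancing_cons | exists (pi c)].
Qed.

Section Domination.
Variables v1 v2 v d : {linear A -> M}.
Hypothesis v1_pos : positive_form form rho v1.
Hypothesis v2_pos : positive_form form rho v2.
Hypothesis vE : forall a, v a = v1 a + v2 a.
Hypothesis dE : forall a, d a = v1 a - v2 a.
Hypothesis d_right : forall a c, C c -> d (a * c) = d a * pi c.

Lemma mform_v xi eta : mform v xi eta = mform v1 xi eta + mform v2 xi eta.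
Proof. exact: (map_form_add rep). Qed.

Lemma mform_d xi eta : mform d xi eta = mform v1 xi eta - mform v2 xi eta.
Proof.
rewrite (map_form_add rep (v := v1) (w := fun a => (-1) *: v2 a)) => [|a].
  congr (_ + _); rewrite -[RHS]mulN1r; exact: (map_form_scale_map rep).
by rewrite dE scaleN1r.
Qed.

Lemma v_pos : positive_form form rho v.
Proof. by move=> xi; rewrite mform_v addr_ge0. Qed.

Let siv := positive_form_semi_inner v_pos.
Let si1 := positive_form_semi_inner v1_pos.
Let si2 := positive_form_semi_inner v2_pos.

Lemma mform_d_balancing n xi : balancing n -> mform d n xi = 0.
Proof.
elim=> [|a c h n' Cc _ IH]; first by rewrite /map_form big_nil.
rewrite (map_form_catl form rho d [:: _; _]) IH addr0.
rewrite /map_form big_cons big_seq1 -big_split big1 // => y _ /=.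
by rewrite mulrA d_right // (star_repM rep) linearN formNl subrr.
Qed.

Lemma mform_d_balancingr n xi : balancing n -> mform d xi n = 0.
Proof.
move=> /(mform_d_balancing xi) h; move: h.
rewrite !mform_d (si_herm si1 n xi) (si_herm si2 n xi) => h.
by rewrite -rmorphB h rmorph0.
Qed.

Definition vmap (xi : X) : H := \sum_(x <- xi) rho (v x.1) x.2.

Lemma vmap_cat xi eta : vmap (xi ++ eta) = vmap xi + vmap eta.
Proof. exact: big_cat. Qed.

Lemma vmap_scale k xi : vmap (scale k xi) = k *: vmap xi.
Proof.
by rewrite /vmap big_map scaler_sumr; apply: eq_bigr => x _ /=; rewrite linearZ.
Qed.

Lemma form_vmap_act b k xi : mform v xi [:: (b, k)] = form (vmap (act (star b) xi)) k.
Proof.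
by rewrite /vmap form_suml /map_form big_map; apply: eq_bigr => x _; rewrite big_seq1.
Qed.

Lemma vmap_bounded : exists2 K : R, 0 <= K &
  forall xi, rnorm (vmap xi) <= K * snorm (mform v) xi.
Proof.
have [K K0 hK] := unit_tensor_bounded normH vn v_pos.
exists K => // xi; set g := vmap xi.
have := rnorm_ge0 g; rewrite le_eqVlt => /orP[/eqP <-|g0].
  by rewrite mulr_ge0 ?snorm_ge0.
have gE : g = vmap (act (star 1) xi) by rewrite star1 tensor_act1.
rewrite -(ler_pM2r g0) -expr2 -[leLHS]ger0_norm ?sqr_ge0 // -normc_real.
rewrite -(form_diag normH) {1}gE -form_vmap_act.
apply: le_trans (Cauchy_Schwarz siv _ _) _.
by rewrite mulrAC [leLHS]mulrC ler_wpM2r ?snorm_ge0.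
Qed.

Lemma balancing_ex : exists n, balancing n.
Proof. by exists [::]; apply: balancing_nil. Qed.

Section Compression.
Variable K : R.
Hypothesis K_ge0 : 0 <= K.
Hypothesis vmap_le : forall xi, rnorm (vmap xi) <= K * snorm (mform v) xi.

(** With Stinespring's [v a = V^* s(a) V] and [Q] the projection onto the
    orthogonal complement of the closure of [balancing], this is [V^* Q]. *)
Definition compress : X -> H :=
  proj_image siv balancing_ex balancing_cat balancing_scale K_ge0 vmap_cat vmap_scale
    vmap_le.

Lemma compress_cat xi eta : compress (xi ++ eta) = compress xi + compress eta.
Proof. exact: proj_imageD. Qed.

Lemma compress_scale k xi : compress (scale k xi) = k *: compress xi.
Proof. exact: proj_imageZ. Qed.

Lemma compress_balancing n : balancing n -> compress n = 0.
Proof. exact: proj_image_N. Qed.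

Lemma compress_ext xi eta : (forall a, vmap (act a xi) = vmap (act a eta)) ->
  compress xi = compress eta.
Proof.
move=> h; apply: proj_image_ext => [z|]; last by have := h 1; rewrite !tensor_act1.
elim: z => [|[b k] z IH].
  by rewrite /map_form !big1 // => *; rewrite big_nil.
by rewrite -cat1s !map_form_catr IH !form_vmap_act h.
Qed.

Lemma act_bounded b xi :
  snorm (mform v) (act b xi) <= (1 + rnorm b) * snorm (mform v) xi.
Proof.
apply: (tensor_act_bounded rep) => //; first exact: v_pos.
  by rewrite ltr_pwDl // rnorm_ge0.
by rewrite lerDr.
Qed.

(** The commutant of [M] acts on the second tensor factor and preserves
    [balancing], as [pi c] lies in [M]. This is what keeps [w] inside [M]. *)
Lemma compress_commutant (T : {linear H -> H}) xi : commutant (range rho) T ->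
  compress (tensor_map T xi) = T (compress xi).
Proof.
move=> cT; have [Tb TC] := cT; have /bounded_mapP[c c0 Tc] := Tb.
have [T' cT' adj] : exists2 T', commutant (range rho) T' & adjoint_of form T T'.
  by apply: (commutant_adjoint normH) cT; case: vn.
have T'c := adjoint_bounded normH adj c0 Tc.
have c1 : 0 < 1 + c by rewrite ltr_pwDl.
apply: (proj_image_intertwine _ _ _ _ _ _ _ _ (T' := tensor_map T') c1 _ _ _ _ c0) => //.
- by move=> x y; apply: map_form_commutant.
- by move=> n; apply: balancing_map.
- by move=> n; apply: balancing_map.
- move=> x; apply: (tensor_map_bounded normH rep rho_inj vn _ v_pos cT').
    by rewrite addr_ge0.
  by move=> h; apply: le_trans (T'c h) _; rewrite ler_wpM2r ?rnorm_ge0 // lerDr.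
- move=> x; rewrite /vmap linear_sum big_map; apply: eq_bigr => y _ /=.
  by rewrite TC //; eexists.
- by move=> h k; rewrite linearD.
- by move=> h k; rewrite linearB.
Qed.

Lemma compression_ex : exists w : {linear A -> M},
  forall a h, rho (w a) h = compress [:: (a, h)].
Proof.
have [a|w hw] := choice (P := fun a m => forall h, rho m h = compress [:: (a, h)]).
  have [c c0 hc] := rep_bounded vn (v (star a * a)).
  apply: (bicommutant_mem vn (k := 2 * K * Num.sqrt c)).
  - move=> k x y; rewrite -compress_scale -compress_cat; apply: compress_ext => b.
    by rewrite /vmap /= !big_cons !big_nil !addr0 linearD.
  - by rewrite !mulr_ge0 ?sqrtr_ge0.
  - move=> h; apply: le_trans (proj_image_bounded _ _ _ _ _ _ _ _ _) _.
    rewrite -[leRHS]mulrA ler_wpM2l ?mulr_ge0 // (snorm_le siv) ?mulr_ge0 ?sqrtr_ge0 ?rnorm_ge0 //.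
    rewrite map_form1 exprMn sqr_sqrtr // (le_trans (ler_Re_normc _)) //.
    rewrite (le_trans (form_CS normH _ _)) // [_ ^+ 2]expr2 mulrA.
    by rewrite ler_wpM2r ?rnorm_ge0.
  - by move=> U cU h; rewrite -compress_commutant.
have [k x y|L hL] := @linear_pack _ _ _ w.
  apply: (rep_ext rho_inj) => h; rewrite (star_repD rep) (star_repZ rep) !hw.
  rewrite -compress_scale -compress_cat; apply: compress_ext => b.
  rewrite /vmap /= !big_cons !big_nil !addr0 /= mulrDr scalemAr linearP.
  by rewrite (star_repD rep) (star_repZ rep) linearZ.
by exists L => a h; rewrite hL hw.
Qed.

Variable w : {linear A -> M}.
Hypothesis wE : forall a h, rho (w a) h = compress [:: (a, h)].

Lemma compression_right a c : C c -> w (a * c) = w a * pi c.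
Proof.
move=> Cc; apply: (rep_ext rho_inj) => h; rewrite (star_repM rep) !wE.
apply/eqP; rewrite -subr_eq0 -scaleN1r -compress_scale -compress_cat /= scaleN1r.
apply/eqP/compress_balancing.
by apply: balancing_cons => //; apply: balancing_nil.
Qed.

Lemma compress_sum xi : compress xi = \sum_(x <- xi) rho (w x.1) x.2.
Proof.
elim: xi => [|[a h] xi IH].
  by rewrite big_nil compress_balancing //; apply: balancing_nil.
by rewrite -cat1s compress_cat big_cat big_seq1 IH wE.
Qed.

Lemma form_compress_act b k xi : mform w xi [:: (b, k)] = form (compress (act (star b) xi)) k.
Proof.
rewrite compress_sum form_suml /map_form big_map; apply: eq_bigr => x _.
by rewrite big_seq1.
Qed.

(** [b (x) k] is [b] applied to [1 (x) k], which moves [star b] to the other side,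
    where it preserves almost orthogonality. The constant [L] depends on [eta]
    only. *)
Lemma compression_approx eta : exists2 L : R, 0 <= L & forall (e : R) xi n, 0 < e ->
  almost_orthogonal (mform v) balancing e xi n ->
  normc (mform w xi eta - mform v (xi ++ n) eta) <= L * e.
Proof.
elim: eta => [|[b k] eta [L L0 IH]].
  exists 0 => // e xi n _ _.
  have mform0 (u : A -> M) zeta : mform u zeta [::] = 0.
    by rewrite /map_form big1 // => x _; rewrite big_nil.
  by rewrite !mform0 subrr normc0 mul0r.
have b1 : 0 < 1 + rnorm b by rewrite ltr_pwDl // rnorm_ge0.
exists (K * (1 + rnorm b) * rnorm k + L) => [|e xi n e0 hn].
  by rewrite addr_ge0 // !mulr_ge0 ?rnorm_ge0 // ltW.
rewrite -cat1s !(map_form_catr form rho _ [:: _] eta) opprD addrACA.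
rewrite (le_trans (le_normcD _ _)) // mulrDl lerD ?IH //.
rewrite form_compress_act form_vmap_act -formBl (le_trans (form_CS normH _ _)) //.
rewrite mulrAC ler_wpM2r ?rnorm_ge0 //.
rewrite /tensor_act map_cat vmap_cat -mulrA.
apply: proj_imageP; first exact: mulr_gt0.
apply: (almost_orthogonal_adjoint (T' := act b)) hn => // [x y|m|m|x].
- by rewrite map_form_act starK.
- exact: balancing_act.
- exact: balancing_act.
- exact: act_bounded.
Qed.

(** On [xi + n] almost orthogonal to [balancing], the forms of [w] and [v] nearly
    agree, while the form of [d] is unchanged by [n]. *)
Lemma compression_dominates (s : R[i]) :
  (forall xi, 0 <= mform v xi xi + s * mform d xi xi) ->
  forall xi, 0 <= mform w xi xi + s * mform d xi xi.
Proof.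
move=> vd xi; apply: ge0_approx => e e0.
have [L L0 hL] := compression_approx xi.
set p := snorm (mform v) xi; have p0 : 0 <= p by apply: snorm_ge0.
pose e' := e / (e + L + p + 1).
have D0 : 0 < e + L + p + 1 by lra.
have e'0 : 0 < e' by rewrite divr_gt0.
have e'1 : e' <= 1 by rewrite ler_pdivrMr // mul1r; lra.
have [n hn] := almost_orthogonal_ex siv balancing_ex balancing_cat balancing_scale xi e'0.
have bn : balancing n by case: hn.
exists (mform v (xi ++ n) (xi ++ n) + s * mform d (xi ++ n) (xi ++ n)) => //.
have -> : mform d (xi ++ n) (xi ++ n) = mform d xi xi.
  rewrite map_form_catl !map_form_catr (mform_d_balancing _ bn) (mform_d_balancing _ bn).
  by rewrite (mform_d_balancingr _ bn) !addr0.
rewrite (map_form_catr form rho v xi n (xi ++ n)).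
set a := mform v (xi ++ n) xi; set b := mform v (xi ++ n) n.
have -> : mform w xi xi + s * mform d xi xi - (a + b + s * mform d xi xi)
    = (mform w xi xi - a) - b by ring.
rewrite (le_trans (le_normcD _ _)) // normcN.
have h1 := hL _ _ _ e'0 hn.
have h2 : normc b <= e' * snorm (mform v) n by rewrite /b map_form_catl; apply: (proj2 hn).
have h3 := almost_orthogonal_snorm siv (ltW e'0) hn.
have h4 : L * e' + e' * (p + e') <= e.
  have : e' * (e + L + p + 1) = e by rewrite mulfVK // gt_eqF.
  nra.
apply: le_trans h4; rewrite lerD //; apply: le_trans h2 _.
by rewrite ler_wpM2l // ltW.
Qed.

End Compression.

(** The compression [w a = V^* Q s(a) Q V] is balanced because [Q] kills
    [balancing]; it still dominates [d], because the form of [d] does not see this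
    subspace. *)
Lemma balanced_domination : exists w : {linear A -> M},
  (forall a c, C c -> w (a * c) = w a * pi c) /\
  (forall s : R[i], (forall xi, 0 <= mform v xi xi + s * mform d xi xi) ->
     forall xi, 0 <= mform w xi xi + s * mform d xi xi).
Proof.
have [K K0 vb] := vmap_bounded; have [w wE] := compression_ex K0 vb.
by exists w; split; [exact: compression_right wE | exact: compression_dominates wE].
Qed.

End Domination.
End BimoduleDomination.

(** * Bimodule decomposition *)

Lemma half_scale (K : numFieldType) (V : lmodType K) (x : V) :
  2^-1 *: x + 2^-1 *: x = x.
Proof.
by rewrite -scalerDl -mulr2n -[2^-1 *+ 2]mulr_natl mulfV ?scale1r ?pnatr_eq0.
Qed.

(** [w + d] and [w - d] are completely positive, as [v + d = 2 v1] and
    [v - d = 2 v2]. In particular [w] is selfadjoint, so that the balancing on the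
    right gives the one on the left. *)
Lemma bimodule_difference (R : realType) (M A : cstarType R) (C : set A)
    (pi : A -> M) (v1 v2 : {linear A -> M}) :
  von_neumann_algebra M -> sub_cstar_algebra C -> C 1 -> unital_star_hom_on C pi ->
  completely_positive v1 -> completely_positive v2 ->
  (forall c1 a c2, C c1 -> C c2 ->
     v1 (c1 * a * c2) - v2 (c1 * a * c2) = pi c1 * (v1 a - v2 a) * pi c2) ->
  exists u1 u2 : {linear A -> M},
    [/\ completely_positive u1 /\ bimodule_map C pi u1,
        completely_positive u2 /\ bimodule_map C pi u2 &
        forall a, v1 a - v2 a = u1 a - u2 a].
Proof.
move=> [H [form [rho [normH rep rho_inj vn]]]] subC C1 homC cp1 cp2 dC.
have pos1 := completely_positive_form normH rep cp1.
have pos2 := completely_positive_form normH rep cp2.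
have lin (k l : R[i]) (f g : {linear A -> M}) : linear (fun a => k *: f a + l *: g a).
  move=> c x y /=; rewrite (linearP f) (linearP g) !scalerDr !scalerA.
  rewrite [k * c]mulrC [l * c]mulrC -!scalerA.
  by rewrite addrACA.
have [v vE] := linear_pack (lin 1 1 v1 v2).
have [d dE] := linear_pack (lin 1 (-1) v1 v2).
have {}vE a : v a = v1 a + v2 a by rewrite vE !scale1r.
have {}dE a : d a = v1 a - v2 a by rewrite dE scale1r scaleN1r.
have d_bimod c1 a c2 : C c1 -> C c2 -> d (c1 * a * c2) = pi c1 * d a * pi c2.
  by move=> h1 h2; rewrite !dE dC.
have d_right a c : C c -> d (a * c) = d a * pi c.
  by move=> Cc; rewrite -[a in LHS]mul1r d_bimod // (star_hom1 homC) mul1r.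
have [w [w_right w_dom]] :=
  balanced_domination normH rep rho_inj vn pos1 pos2 vE dE d_right.
have half (s : R[i]) : exists u : {linear A -> M}, forall a, u a = 2^-1 *: (w a + s *: d a).
  have [u uE] := linear_pack (lin 2^-1 (2^-1 * s) w d).
  by exists u => a; rewrite uE scalerDr scalerA.
have half_pos (s : R[i]) (u : {linear A -> M}) : (forall a, u a = 2^-1 *: (w a + s *: d a)) ->
    (forall xi, 0 <= map_form form rho v xi xi + s * map_form form rho d xi xi) ->
    positive_form form rho u.
  move=> uE vd xi.
  rewrite (map_form_scale_map rep _ _ uE) mulr_ge0 ?invr_ge0 //.
  rewrite (map_form_add rep (v := w) (w := fun a => s *: d a)) //.
  by rewrite (map_form_scale_map rep (u := fun a => s *: d a) (v := d) (k := s)) // w_dom.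
have [u1 u1E] := half 1; have [u2 u2E] := half (-1).
have u1_pos : positive_form form rho u1.
  apply: (half_pos _ _ u1E) => xi.
  rewrite mul1r (mform_v rep vE) (mform_d rep dE) addrACA subrr addr0.
  by rewrite addr_ge0.
have u2_pos : positive_form form rho u2.
  apply: (half_pos _ _ u2E) => xi.
  rewrite mulN1r (mform_v rep vE) (mform_d rep dE) opprB addrC addrA subrK.
  by rewrite addr_ge0.
have w_star a : w (star a) = star (w a).
  have wE b : w b = u1 b + u2 b.
    rewrite u1E u2E -scalerDr scale1r scaleN1r addrACA subrr addr0.
    by rewrite scalerDr half_scale.
  rewrite !wE (positive_form_star normH rep rho_inj a u1_pos).
  by rewrite (positive_form_star normH rep rho_inj a u2_pos) starD.
have w_left c a : C c -> w (c * a) = pi c * w a.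
  move=> Cc; have Cc' := sub_cstar_star subC Cc.
  rewrite -[c * a]starK w_star star_mul w_right // star_mul w_star starK.
  by rewrite (star_hom_star homC) // starK.
have w_bimod c1 a c2 : C c1 -> C c2 -> w (c1 * a * c2) = pi c1 * w a * pi c2.
  by move=> h1 h2; rewrite w_right // w_left.
have bimod (s : R[i]) (u : {linear A -> M}) : (forall a, u a = 2^-1 *: (w a + s *: d a)) ->
    positive_form form rho u -> completely_positive u /\ bimodule_map C pi u.
  move=> uE u_pos; split.
    exact: (positive_form_completely_positive normH rep rho_inj vn u_pos).
  split=> [|c1 a c2 h1 h2].
    exact: (positive_form_bounded normH rep rho_inj vn u_pos).
  rewrite !uE w_bimod // d_bimod // scalemAr scalemAl; congr (_ *: _).
  by rewrite mulrDr mulrDl scalemAr scalemAl.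
exists u1, u2; split; [exact: bimod u1E u1_pos | exact: bimod u2E u2_pos | move=> a].
rewrite u1E u2E -dE -scalerBr scale1r scaleN1r opprB addrC addrA addrNK.
by rewrite scalerDr half_scale.
Qed.

Unset Implicit Arguments.
Set Strict Implicit.

Theorem theorem2p2 (R : realType) (M A : cstarType R) (C : set A)
    (pi : A -> M) (u : {linear A -> M}) :
  von_neumann_algebra M ->
  sub_cstar_algebra C -> C 1 ->
  unital_star_hom_on C pi ->
  bimodule_map C pi u ->
  decomposable u ->
  (exists pihat : {linear A -> M}, cp_extension C pi pihat) ->
  exists u1 u2 u3 u4 : {linear A -> M},
    [/\ completely_positive u1 /\ bimodule_map C pi u1,
        completely_positive u2 /\ bimodule_map C pi u2,
        completely_positive u3 /\ bimodule_map C pi u3,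
        completely_positive u4 /\ bimodule_map C pi u4 &
        forall a, u a = (u1 a - u2 a) + 'i *: (u3 a - u4 a)].
Proof.
move=> vnM subC C1 homC [_ u_bimod] [v1 [v2 [v3 [v4 [cp1 cp2 cp3 cp4 uE]]]]] _.
have [H [form [rho [normH rep rho_inj vn]]]] := vnM.
have v_star (v : {linear A -> M}) a : completely_positive v -> v (star a) = star (v a).
  move=> /(completely_positive_form normH rep).
  exact: (positive_form_star normH rep rho_inj a).
have i_conj : ('i : R[i])^* = - 'i by rewrite ?complexiE conjCi.
pose ut a := star (u (star a)).
have utE a : ut a = (v1 a - v2 a) - 'i *: (v3 a - v4 a).
  rewrite /ut uE starD starZ !starB !v_star // !starK i_conj.
  by rewrite scaleNr.
have ut_bimod c1 a c2 : C c1 -> C c2 -> ut (c1 * a * c2) = pi c1 * ut a * pi c2.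
  move=> h1 h2; have h1' := sub_cstar_star subC h1; have h2' := sub_cstar_star subC h2.
  rewrite /ut !star_mul mulrA u_bimod //.
  by rewrite !star_mul !(star_hom_star homC) // !starK mulrA.
(* [u] and its adjoint [ut] are bimodule maps; [v1 - v2] and [v3 - v4] are the
   real and imaginary parts of [u]. *)
have re_u a : v1 a - v2 a = 2^-1 *: (u a + ut a).
  by rewrite uE utE addrACA subrr addr0 scalerDr half_scale.
have im_u a : v3 a - v4 a = (2^-1 * - 'i) *: (u a - ut a).
  rewrite uE utE opprB [in RHS]addrC addrA subrK -scalerDr scalerA.
  have -> : 2^-1 * - 'i * 'i = 2^-1 :> R[i].
    by rewrite ?complexiE mulrN mulNr -mulrA -expr2 sqrCi mulrN1 opprK.
  by rewrite scalerDr half_scale.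
have [|u1 [u2 [h1 h2 h12]]] := bimodule_difference vnM subC C1 homC cp1 cp2.
  move=> c1 a c2 Cc1 Cc2; rewrite !re_u u_bimod // ut_bimod //.
  by rewrite scalemAr scalemAl mulrDr mulrDl.
have [|u3 [u4 [h3 h4 h34]]] := bimodule_difference vnM subC C1 homC cp3 cp4.
  move=> c1 a c2 Cc1 Cc2; rewrite !im_u u_bimod // ut_bimod //.
  by rewrite scalemAr scalemAl mulrBr mulrBl.
by exists u1, u2, u3, u4; split=> // a; rewrite uE h12 h34.
Qed.
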